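(* Let $d\ge2$, $k\ge1$, $\beta\in[0,1]$, let $\kappa_1,\dots,\kappa_k>0$ be concentration parameters and $\alpha_1,\dots,\alpha_k\ge0$ with $\sum_i\alpha_i=1$ mixture weights, and let $d_1$ be a pseudo-metric on $\mathbb{R}$. Then $\mathrm{MSSFG}(\cdot,\cdot;\beta,\{\kappa_i\},\{\alpha_i\})$ is a pseudo-metric on $\mathcal{P}(\mathbb{R}^d)$: it is non-negative, symmetric, and there is a constant $C'>0$ with $\mathrm{MSSFG}(\mu,\xi)\le C'[\mathrm{MSSFG}(\mu,\nu)+\mathrm{MSSFG}(\nu,\xi)]$ for all $\mu,\nu,\xi\in\mathcal{P}(\mathbb{R}^d)$.
   Context: $\mathcal{P}(\mathbb{R}^d)$: probability measures on $\mathbb{R}^d$ with finite moments. A pseudo-metric $d_1$ on $\mathbb{R}$ is non-negative, symmetric, and satisfies $d_1(x,z)\le C[d_1(x,y)+d_1(y,z)]$ for a universal $C>0$. $\mathbb{S}^{d-1}$ is the unit sphere; $\theta\sharp\mu$ is the pushforward of $\mu$ under $x\mapsto\theta^\top x$. For probability measures $\rho,\eta$ on $\mathbb{R}$ with coupling set $\Pi(\rho,\eta)$, $D_{fgw}(\rho,\eta;\beta,d_1)=\min_{\pi\in\Pi(\rho,\eta)}\Big\{(1-\beta)\int d_1(s,t)\,d\pi+\beta\iint[d_1(s,s')-d_1(t,t')]^2d\pi(s,t)d\pi(s',t')\Big\}$. $\mathrm{vMF}(\cdot\mid\epsilon,\kappa)$ has density $C_d(\kappa)\exp(\kappa\epsilon^\top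 x)$ w.r.t. surface measure on $\mathbb{S}^{d-1}$, $C_d(\kappa)=\kappa^{d/2-1}/((2\pi)^{d/2}I_{d/2-1}(\kappa))$. The mixture $\mathrm{MovMF}(\cdot\mid\epsilon_{1:k},\kappa_{1:k},\alpha_{1:k})=\sum_{i=1}^k\alpha_i\mathrm{vMF}(\cdot\mid\epsilon_i,\kappa_i)$, and $\mathrm{MSSFG}(\mu,\nu;\beta,\{\kappa_i\},\{\alpha_i\})=\max_{\epsilon_1,\dots,\epsilon_k\in\mathbb{S}^{d-1}}\mathbb{E}_{\theta\sim\mathrm{MovMF}(\cdot\mid\epsilon_{1:k},\kappa_{1:k},\alpha_{1:k})}[D_{fgw}(\theta\sharp\mu,\theta\sharp\nu;\beta,d_1)]$. *)

(* Defs.v *)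
From mathcomp Require Import all_boot all_order all_algebra.
From mathcomp Require Import all_classical all_reals all_analysis.
Import numFieldNormedType.Exports.
Import Order.TTheory GRing.Theory Num.Theory.

Set Implicit Arguments.
Unset Strict Implicit.
Unset Printing Implicit Defensive.

Local Open Scope classical_set_scope.
Local Open Scope ring_scope.

Section Defs.
Variable R : realType.

(** ** Euclidean space R^n, represented as n.-tuple R with the product
    (= Borel) sigma-algebra. *)
Definition dotT (n : nat) (x y : n.-tuple R) : R :=
  \sum_(i < n) tnth x i * tnth y i.

Definition normT (n : nat) (x : n.-tuple R) : R := Num.sqrt (dotT x x).

Definition scaleT (n : nat) (t : R) (x : n.-tuple R) : n.-tuple R :=
  map_tuple (fun a => t * a) x.

Definition sphere (n : nat) : set (n.-tuple R) := [set x | dotT x x = 1].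

Fixpoint lebT (n : nat) : set (n.-tuple R) -> \bar R :=
  match n return set (n.-tuple R) -> \bar R with
  | 0 => fun A => \d_ [tuple] A
  | n'.+1 => pushforward ((@lebesgue_measure R) \x (@lebT n'))%E
               (fun p : R * n'.-tuple R => cons_tuple p.1 p.2)
  end.

(** Surface measure on S^{n-1}, defined (as usual) through the cone
    construction: sigma(A) = n * lambda_n({t y | 0 < t <= 1, y in A}). *)
Definition cone (n : nat) (A : set (n.-tuple R)) : set (n.-tuple R) :=
  [set x | exists t : R, 0 < t <= 1 /\ exists2 y, (A `&` @sphere n) y & x = scaleT t y].

Definition surface (n : nat) (A : set (n.-tuple R)) : \bar R :=
  (n%:R%:E * @lebT n (cone A))%E.

Definition Gamma (s : R) : R :=
  fine (\int[@lebesgue_measure R]_(t in [set t : R | (0 < t)%R]) ((t `^ (s - 1)) * expR (- t))%R%:E)%E.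

Definition besselI (nu x : R) : R :=
  fine (\sum_(m <oo) (((x / 2) `^ (2 * m%:R + nu)) / (m`!%:R * Gamma (m%:R + nu + 1)))%R%:E)%E.

Definition vmfC (d : nat) (kappa : R) : R :=
  kappa `^ (d%:R / 2 - 1) /
  ((2 * pi) `^ (d%:R / 2) * besselI (d%:R / 2 - 1) kappa).

Definition vmf_density (d : nat) (eps : d.-tuple R) (kappa : R) (x : d.-tuple R) : R :=
  vmfC d kappa * expR (kappa * dotT eps x).

Definition MovMF (d k : nat) (eps : 'I_k -> d.-tuple R) (kappa alpha : 'I_k -> R)
    (A : set (d.-tuple R)) : \bar R :=
  (\sum_(i < k) (alpha i)%:E *
     \int[surface (n:=d)]_(x in A `&` @sphere d) (vmf_density (eps i) (kappa i) x)%R%:E)%E.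

Definition proj_push (d : nat) (theta : d.-tuple R) (mu : set (d.-tuple R) -> \bar R)
  : set R -> \bar R := pushforward mu (dotT theta).

Definition couplings (rho eta : set R -> \bar R) : set (probability (R * R)%type R) :=
  [set pi | (forall A : set R, measurable A -> pi (fst @^-1` A) = rho A) /\
            (forall A : set R, measurable A -> pi (snd @^-1` A) = eta A)].

(** Fused Gromov-Wasserstein objective and discrepancy (the minimum over
    couplings is rendered as the infimum). *)
Definition fgw_cost (beta : R) (d1 : R -> R -> R) (pi : probability (R * R)%type R) : \bar R :=
  ((1 - beta)%R%:E * \int[pi]_p (d1 p.1 p.2)%R%:E +
   beta%:E * \int[pi]_p \int[pi]_q ((d1 p.1 q.1 - d1 p.2 q.2) ^+ 2)%R%:E)%E.

Definition D_fgw (rho eta : set R -> \bar R) (beta : R) (d1 : R -> R -> R) : \bar R :=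
  ereal_inf [set fgw_cost beta d1 pi | pi in couplings rho eta].

Definition MSSFG (d k : nat) (mu nu : set (d.-tuple R) -> \bar R) (beta : R)
    (d1 : R -> R -> R) (kappa alpha : 'I_k -> R) : \bar R :=
  ereal_sup [set (\int[MovMF eps kappa alpha]_theta
                    D_fgw (proj_push theta mu) (proj_push theta nu) beta d1)%E
            | eps in [set eps : 'I_k -> d.-tuple R | forall i, @sphere d (eps i)]].

Definition pseudo_metric (d1 : R -> R -> R) : Prop :=
  (forall x y, 0 <= d1 x y) /\
  (forall x y, d1 x y = d1 y x) /\
  (exists C : R, 0 < C /\ forall x y z, d1 x z <= C * (d1 x y + d1 y z)).

Definition finite_moments (d : nat) (mu : probability (d.-tuple R) R) : Prop :=
  forall p : nat, (\int[mu]_x ((normT x) ^+ p)%R%:E < +oo)%E.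

End Defs.

(* Main.v *)
(** Gluing couplings along a common marginal gives the quasi-triangle inequality
    for the fused Gromov-Wasserstein discrepancy on the line, pointwise in the
    projection direction [theta]. The difficulty is to integrate it over
    [theta]: the discrepancy is an infimum over uncountably many couplings with a
    merely Borel cost, so it need not be Borel in [theta], and the integral of a
    non-measurable function is a lower integral, which is not subadditive.
    Sublevel sets of the discrepancy are however projections of measurable sets:
    every law on the plane is that of a jointly measurable function of a code in
    [nat -> nat] and of a uniform variable, so the infimum can be taken over
    codes. By the measurable projection theorem (Choquet capacitability of Souslin
    sets) the discrepancy agrees, outside a set that is null for the surface
    measure, with a measurable minorant, and this restores subadditivity.
    Gluing itself rests on conditional distribution functions obtained from the
    Radon-Nikodym theorem and turned into conditional quantile functions. *)

Require Import Defs.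
From HB Require Import structures.
From mathcomp Require Import all_boot all_order all_algebra.
From mathcomp Require Import all_classical all_reals all_analysis.
From mathcomp Require Import measurable_realfun.
Import numFieldNormedType.Exports.
Import Order.TTheory GRing.Theory Num.Theory.
Set Implicit Arguments.
Unset Strict Implicit.
Unset Printing Implicit Defensive.
From mathcomp Require Import ring lra.
Local Open Scope classical_set_scope.
Local Open Scope ring_scope.

(** * Souslin sets are universally measurable *)

(** The minorant is built for the surface measure, which dominates every mixture, so its exceptional
    null set does not depend on [eps]; the inequality is integrated at fixed [eps] and the supremum
    comes last. Approximating from below is the right direction: the lower integral of the
    discrepancy is at least the integral of any measurable nonnegative function below it. The
    constant [max C 2] has two origins: [C] pays for the transport term through the triangle
    inequality of [d1], and 2 pays for the distortion term through
    [(a - c)^2 <= 2((a - b)^2 + (b - c)^2)]. Codes live in [nat -> nat] because its cylinders form a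
    tree: measurable sets of a product with it are given by Souslin schemes directly, without a
    topology on the space of laws. A code lists rational data of a distribution function on the
    line, so the plane is first embedded measurably in the line. Quantile functions then serve
    twice: with a conditional law they produce gluings, with a code they produce samples. *)

Section outer_hull.
Context d (T : measurableType d) (R : realType).
Variable m : {measure set T -> \bar R}.
Local Open Scope ereal_scope.

Definition outer (S : set T) : \bar R :=
  ereal_inf [set m B | B in [set B | measurable B /\ S `<=` B]].

Lemma outer_lb S B : measurable B -> S `<=` B -> outer S <= m B.
Proof. by move=> mB SB; apply: ereal_inf_lbound; exists B. Qed.

(** Intersecting measurable supersets whose measures approach the infimum attains it; the whole
    space serves when the infimum is infinite. *)
Lemma outer_hull S : exists B, [/\ measurable B, S `<=` B & m B = outer S].
Proof.
have [oS|] := eqVneq (outer S) +oo.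
  exists setT; split => //; apply/le_anti/andP; split; first by rewrite oS leey.
  exact: outer_lb.
rewrite -ltey => oS.
have o0 : 0 <= outer S by apply: le_ereal_inf_tmp => _ [B _ <-].
have fS : outer S \is a fin_num by rewrite ge0_fin_numE.
have H (n : nat) : exists B, [/\ measurable B, S `<=` B &
    m B < outer S + (n.+1%:R^-1)%:E].
  have [_ [B [mB SB] <-] lt] := @lb_ereal_inf_adherent _
    [set m B | B in [set B | measurable B /\ S `<=` B]] n.+1%:R^-1
    (ltac:(by rewrite invr_gt0 ltr0n)) fS.
  by exists B.
have [F HF] := choice H.
have mF n : measurable (F n) by have [] := HF n.
exists (\bigcap_n F n); split.
- exact: bigcapT_measurable.
- by move=> x Sx n _; have [_ + _] := HF n; apply.
apply/le_anti/andP; split; last first.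
  apply: outer_lb; first exact: bigcapT_measurable.
  by move=> x Sx n _; have [_ + _] := HF n; apply.
apply/lee_addgt0Pr => e e0.
have [n ne] : exists n, (n.+1%:R^-1 < e)%R.
  have [n _ /(_ n (leqnn _))] := near_infty_natSinv_lt (PosNum e0).
  by exists n.
have [_ _ /ltW lt] := HF n.
apply: (@le_trans _ _ (m (F n))).
  apply: le_measure; rewrite ?inE//; first exact: bigcapT_measurable.
  by move=> x; apply.
by apply: (le_trans lt); rewrite leeD2l// lee_fin ltW.
Qed.

Lemma le_outer S1 S2 : S1 `<=` S2 -> outer S1 <= outer S2.
Proof.
move=> S12; have [B [mB SB <-]] := outer_hull S2.
by apply: outer_lb => //; exact: subset_trans SB.
Qed.

(** Continuity from below on arbitrary sets, the capacity property behind Choquet's argument. The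
    hulls of the [S j] need not increase, but the intersections of all later hulls do, and they
    still contain [S j]. *)
Lemma lt_outer_bigcup (S : (set T)^nat) c :
  nondecreasing_seq S -> c < outer (\bigcup_j S j) -> exists j, c < outer (S j).
Proof.
move=> ndS cS; apply: contrapT => /forallNP nc.
have {}nc j : outer (S j) <= c by rewrite leNgt; apply/negP/nc.
have [B HB] := choice (fun j => outer_hull (S j)).
have mB j : measurable (B j) by have [] := HB j.
pose B' j := \bigcap_(i in [set i | (j <= i)%N]) B i.
have mB' j : measurable (B' j) by exact: bigcap_measurableType.
have ndB' : nondecreasing_seq B'.
  by move=> i j ij; apply/subsetPset => x H k /= jk; apply: H => /=; exact: leq_trans jk.
have cB := nondecreasing_cvg_mu (mu := m) mB' (bigcupT_measurable _ mB') ndB'.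
move: cS; apply/negP; rewrite -leNgt.
apply: (@le_trans _ _ (m (\bigcup_n B' n))).
  apply: outer_lb; first exact: bigcupT_measurable.
  move=> x [j _ Sx]; exists j => // i /= ji.
  have [_ + _] := HB i; apply.
  by have /subsetPset := ndS _ _ ji; apply.
rewrite -(cvg_lim _ cB)//; apply: lime_le; first by apply/cvg_ex; eexists; exact: cB.
apply: nearW => j /=; apply: (le_trans _ (nc j)).
have [_ _ <-] := HB j; apply: le_measure; rewrite ?inE//.
by move=> x; apply => /=.
Qed.

End outer_hull.

(** The Souslin operation: a union over infinite branches of the intersection of the sets met along
    each branch. *)
Definition souslin T (A : seq nat -> set T) : set T :=
  [set x | exists f : nat -> nat, forall n, A (mkseq f n) x].

Section souslin_measurable.
Context d (T : measurableType d) (R : realType).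
Variable m : {finite_measure set T -> \bar R}.
Variable A : seq nat -> set T.
Hypothesis mA : forall s, measurable (A s).
Local Open Scope ereal_scope.

(** Only the first [size b] values of the branch are bounded. Bounding one more value at a time
    keeps the outer measure under control. *)
Definition souslin_bounded (b : seq nat) : set T :=
  [set x | exists f : nat -> nat,
    (forall i, (i < size b)%N -> (f i <= nth 0%N b i)%N) /\
    forall n, A (mkseq f n) x].

(** As [j] grows these sets increase to the set for [b], so continuity from below finds a bound that
    loses too little to fall to [c]. *)
Lemma souslin_bounded_step b c : c < outer m (souslin_bounded b) ->
  exists j, c < outer m (souslin_bounded (rcons b j)).
Proof.
move=> cb; apply: lt_outer_bigcup => [i j ij|].
  apply/subsetPset => x [f [fb fA]]; exists f; split => // k.
  rewrite size_rcons => kb; apply: (leq_trans (fb k _)); first by rewrite size_rcons.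
  by rewrite !nth_rcons; case: ifP => // _; case: ifP.
apply: (lt_le_trans cb); apply: le_outer => x [f [fb fA]].
exists (f (size b)) => //; exists f; split => // k.
rewrite size_rcons ltnS leq_eqVlt => /orP[/eqP ->|kb].
  by rewrite nth_rcons ltnn eqxx.
by rewrite nth_rcons kb; exact: fb.
Qed.

(** A measurable relaxation: it asks for a bounded word of length [n], not for an infinite branch,
    so the union ranges over words. *)
Definition souslin_approx (beta : nat -> nat) (n : nat) : set T :=
  \bigcup_(s in [set s : seq nat | size s = n /\
       forall i, (i < n)%N -> (nth 0%N s i <= beta i)%N])
    \bigcap_(k in [set k | (k <= n)%N]) A (take k s).

Lemma measurable_souslin_approx beta n : measurable (souslin_approx beta n).
Proof.
rewrite /souslin_approx bigcup_mkcond; apply: countable_bigcupT_measurable => // s.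
by case: ifP => // _; exact: bigcap_measurableType.
Qed.

Lemma nonincreasing_souslin_approx beta : nonincreasing_seq (souslin_approx beta).
Proof.
move=> n p np; apply/subsetPset => x [s [sp sb] sA].
exists (take n s); first split.
- by rewrite size_takel// sp.
- by move=> i ni; rewrite nth_take//; apply: sb; exact: leq_trans np.
- move=> k /= kn; rewrite take_takel//; apply: sA => /=; exact: leq_trans np.
Qed.

(* Koenig's lemma: the tree of initial segments below [beta] is finitely branching. *)
Lemma bigcap_souslin_approx beta :
  \bigcap_n souslin_approx beta n `<=` souslin A.
Proof.
move=> x xT.
pose valid s := (forall i, (i < size s)%N -> (nth 0%N s i <= beta i)%N) /\
  forall k, (k <= size s)%N -> A (take k s) x.
(* For [n] beyond the length of [s] this says that a valid word of length [n] extends [s]; for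
   smaller [n] it says that the prefix of [s] is valid. *)
pose good s := forall n, exists t, [/\ size t = n, take (size s) t = take n s & valid t].
have valid_take n t : valid t -> valid (take n t).
  have [nt|tn] := leqP n (size t); last by rewrite take_oversize// ltnW.
  move=> [vb vA]; split => [i|k]; rewrite size_takel// => Hi.
    by rewrite nth_take//; apply: vb; exact: leq_trans nt.
  by rewrite take_takel//; apply: vA; exact: leq_trans nt.
have good0 : good [::].
  move=> n; have [s [sn sb] sA] := xT n I.
  exists s; split => //; first by rewrite take0.
  by split=> [i|k]; rewrite sn => Hi; [exact: sb|exact: sA].
have good_valid s : good s -> valid s.
  by move=> /(_ (size s)) [t [ts]]; rewrite take_size take_oversize ?ts// => ->.
have step s : good s -> exists j, good (rcons s j).
  move=> gs; apply: contrapT => /forallNP ng.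
  have {}ng j : exists n, ~ exists t,
      [/\ size t = n, take (size (rcons s j)) t = take n (rcons s j) & valid t].
    exact/existsNP/ng.
  have [N HN] := choice ng.
  (* If every child died, child [j] would have no valid extension of length [N j]. A valid word
     longer than all these lengths passes through some child allowed by [beta], a contradiction. *)
  pose M := ((size s).+1 + \max_(j < (beta (size s)).+1) N j)%N.
  have [t [tM ts vt]] := gs M.
  have sM : (size s < M)%N by rewrite /M addSn ltnS leq_addr.
  rewrite (take_oversize (ltnW sM)) in ts.
  have jb : (nth 0%N t (size s) <= beta (size s))%N.
    by case: vt => vb _; apply: vb; rewrite tM.
  set j := nth 0%N t (size s) in jb *.
  apply: (HN j); exists (take (N j) t).
  have NM : (N j <= M)%N.
    rewrite /M (leq_trans _ (leq_addl _ _))//.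
    by rewrite -[j]/(nat_of_ord (Ordinal (jb : (j < (beta (size s)).+1)%N))) leq_bigmax.
  split.
  - by rewrite size_takel ?tM.
  - have E : rcons s j = take (size s).+1 t by rewrite (take_nth 0%N) ?tM// ts.
    by rewrite size_rcons E takeC.
  - exact: valid_take.
have good_next s : exists j, good s -> good (rcons s j).
  by have [/step[j]|ns] := pselect (good s); [exists j|exists 0%N].
have [g Hg] := choice good_next.
pose bs := fix bs n := if n is n'.+1 then rcons (bs n') (g (bs n')) else [::].
have gbs n : good (bs n) by elim: n => //= n IH; exact: Hg.
have bsE n : bs n = mkseq (fun i => g (bs i)) n.
  by elim: n => //= n {1}->; rewrite mkseqS.
exists (fun i => g (bs i)) => n; rewrite -bsE.
have [_ /(_ n)] := good_valid _ (gbs n).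
by rewrite bsE size_mkseq leqnn take_oversize ?size_mkseq//; apply.
Qed.

(** Choose [beta] value by value so that every bounded set keeps outer measure above [c]. The
    relaxations contain these sets and decrease, so by finiteness of [m] their intersection has
    measure at least [c]; Koenig's lemma puts it inside the Souslin set. *)
Lemma souslin_inner c : c < outer m (souslin A) ->
  exists B, [/\ measurable B, B `<=` souslin A & c <= m B].
Proof.
move=> cA.
have next b : exists j, c < outer m (souslin_bounded b) ->
    c < outer m (souslin_bounded (rcons b j)).
  have [/souslin_bounded_step[j]|ns] := pselect (c < outer m (souslin_bounded b)).
    by exists j.
  by exists 0%N.
have [g Hg] := choice next.
pose bs := fix bs n := if n is n'.+1 then rcons (bs n') (g (bs n')) else [::].
have cbs n : c < outer m (souslin_bounded (bs n)).
  elim: n => /= [|n /Hg//].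
  by apply: (lt_le_trans cA); apply: le_outer => x [f fA]; exists f.
pose beta i := g (bs i).
have bsE n : bs n = mkseq beta n by elim: n => //= n {1}->; rewrite mkseqS.
pose F := souslin_approx beta.
have mF n : measurable (F n) by exact: measurable_souslin_approx.
exists (\bigcap_n F n); split.
- exact: bigcapT_measurable.
- exact: bigcap_souslin_approx.
have F0 : m (F 0%N) < +oo by rewrite ltey_eq fin_num_measure.
have cF := nonincreasing_cvg_mu (mu := m) F0 mF
  (bigcapT_measurable mF) (@nonincreasing_souslin_approx beta).
rewrite -(cvg_lim _ cF)//; apply: lime_ge; first by apply/cvg_ex; eexists; exact: cF.
apply: nearW => n /=; apply: (le_trans (ltW (cbs n))).
apply: outer_lb => // x [f [fb fA]].
exists (mkseq f n); first split.
- exact: size_mkseq.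
- move=> i ni; rewrite nth_mkseq//; apply: (leq_trans (fb i _)); first by rewrite bsE size_mkseq.
  by rewrite bsE nth_mkseq.
- move=> k /= kn; suff -> : take k (mkseq f n) = mkseq f k by [].
  by rewrite /mkseq -map_take take_iota (minn_idPl kn).
Qed.

Lemma souslin_sandwich : exists B C, [/\ measurable B, measurable C,
  B `<=` souslin A, souslin A `<=` C & m (C `\` B) = 0].
Proof.
have [C [mC SC Co]] := outer_hull m (souslin A).
have fC : m C \is a fin_num by exact: fin_num_measure.
have H (n : nat) : exists B, [/\ measurable B, B `<=` souslin A &
    m C - (n.+1%:R^-1)%:E <= m B].
  apply: souslin_inner; rewrite -Co -[X in X - _](fineK fC) -[ltRHS](fineK fC) -EFinB lte_fin.
  by rewrite ltrBlDr ltrDl invr_gt0 ltr0n.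
have [F HF] := choice H.
have mF n : measurable (F n) by have [] := HF n.
have FS : \bigcup_n F n `<=` souslin A.
  by move=> x [n _]; have [_ + _] := HF n; apply.
have mU := bigcupT_measurable _ mF.
exists (\bigcup_n F n), C; split => //.
rewrite measureD//; last by rewrite ltey_eq fC.
have -> : C `&` \bigcup_n F n = \bigcup_n F n.
  by apply/setIidPr; exact: subset_trans SC.
suff E : m (\bigcup_n F n) = m C by rewrite [X in _ - X]E subee.
apply/le_anti/andP; split.
  by apply: le_measure; rewrite ?inE//; exact: subset_trans SC.
apply/lee_addgt0Pr => e e0.
have [n ne] : exists n, (n.+1%:R^-1 < e)%R.
  have [n _ /(_ n (leqnn _))] := near_infty_natSinv_lt (PosNum e0).
  by exists n.
have [_ _] := HF n; rewrite leeBlDr// => /le_trans; apply.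
apply: leeD; last by rewrite lee_fin ltW.
by apply: le_measure; rewrite ?inE//; exact: bigcup_sup.
Qed.

End souslin_measurable.

(** * Measurable projection *)

Definition baire_cylinder : set (set (nat -> nat)) :=
  [set C | exists i j, C = [set z | z i = j]].

(** Baire space with the sigma-algebra generated by its coordinates; its points will be the codes of
    laws. *)
Definition baire := g_sigma_algebraType baire_cylinder.

Lemma measurable_baire_coord i (P : nat -> Prop) :
  measurable [set z : baire | P ((z : nat -> nat) i)].
Proof.
rewrite (_ : [set _ | _] = \bigcup_(j in P) [set z : baire | (z : nat -> nat) i = j]).
  apply: bigcup_measurable => j _; apply: sub_sigma_algebra; exists i, j => //.
by apply/seteqP; split => [z Pz|z [j Pj /= ->]//]; exists ((z : nat -> nat) i).
Qed.

Section projection.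
Context d (X : measurableType d).

(* Souslin sets of the product [X * baire]: the second coordinate is itself
   the branch of a tree, so that projecting on [X] only merges two branches. *)
Definition analytic (B : set (X * baire)) : Prop :=
  exists A : seq nat -> seq nat -> set X,
    (forall s t, measurable (A s t)) /\
    forall x (z : nat -> nat), B (x, z) <->
      exists w : nat -> nat, forall n, A (mkseq z n) (mkseq w n) x.

(** The first digit of the witness names the index [i] and the others form a witness for [B i]. This
    shifts the depth by one, hence the truncation of [s] to [size t']. *)
Lemma analytic_bigcup (B : (set (X * baire))^nat) :
  (forall i, analytic (B i)) -> analytic (\bigcup_i B i).
Proof.
move=> /choice[A HA].
pose A' s t := if t is i :: t' then A i (take (size t') s) t' else setT.
have A'E s i t : A' s (i :: t) = A i (take (size t) s) t by [].
exists A'; split.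
  by move=> s [|i t]; rewrite /A'//; have [+ _] := HA i; exact.
have takeS (z : nat -> nat) n : take n (mkseq z n.+1) = mkseq z n.
  by rewrite mkseqS -cats1 take_cat size_mkseq ltnn subnn cats0.
have mkseqSr (w : nat -> nat) n : mkseq w n.+1 = w 0%N :: mkseq (w \o succn) n.
  by rewrite /mkseq /= -[1%N]addn0 iotaDl -map_comp.
move=> x z; split => [[i _]|[w Hw]].
  have [_ /(_ x z) ->] := HA i => -[w Hw].
  exists (fun n => if n is n'.+1 then w n' else i) => -[//|n].
  by rewrite (mkseqSr (fun n => if n is n'.+1 then w n' else i)) A'E size_mkseq takeS; exact: Hw.
exists (w 0%N) => //; have [_ /(_ x z) ->] := HA (w 0%N).
by exists (w \o succn) => n; have := Hw n.+1; rewrite (mkseqSr w) A'E size_mkseq takeS.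
Qed.

(** One witness interleaves a witness for each [i]: digit [k] of the [i]-th sits at position
    [pickle (i, k)]. [D N i] collects the depths at which the [i]-th scheme can be read from the
    first [N] digits. *)
Lemma analytic_bigcap (B : (set (X * baire))^nat) :
  (forall i, analytic (B i)) -> analytic (\bigcap_i B i).
Proof.
move=> /choice[A HA].
pose D (N i : nat) := [set n | (n <= N)%N /\ forall k, (k < n)%N -> (pickle (i, k) < N)%N].
exists (fun s t => \bigcap_i \bigcap_(n in D (size t) i)
  A i (take n s) [seq nth 0%N t (pickle (i, k)) | k <- iota 0 n]); split.
  move=> s t; apply: bigcapT_measurable => i; apply: bigcap_measurableType => n _.
  by have [+ _] := HA i; exact.
have take_mkseq (z : nat -> nat) n N : (n <= N)%N -> take n (mkseq z N) = mkseq z n.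
  by move=> nN; rewrite /mkseq -map_take take_iota (minn_idPl nN).
have nth_code (w : nat -> nat) N i n : D N i n ->
    [seq nth 0%N (mkseq w N) (pickle (i, k)) | k <- iota 0 n] =
    mkseq (fun k => w (pickle (i, k))) n.
  move=> [nN HN]; apply/eq_in_map => k; rewrite mem_iota add0n => /andP[_ kn].
  by rewrite nth_mkseq//; exact: HN.
move=> x z; split => [Bxz|[w Hw] i _].
  have /choice[w Hw] : forall i, exists w : nat -> nat, forall n, A i (mkseq z n) (mkseq w n) x.
    by move=> i; have [_ /(_ x z) <-] := HA i; exact: Bxz.
  exists (fun j => if unpickle j is Some p then w p.1 p.2 else 0%N) => N i _ n.
  rewrite size_mkseq => Dn; rewrite nth_code// take_mkseq; last by case: Dn.
  by rewrite [X in A _ _ X](_ : _ = mkseq (w i) n)//; apply: eq_mkseq => k; rewrite pickleK.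
have [_ /(_ x z) ->] := HA i.
exists (fun k => w (pickle (i, k))) => n.
(* Deep enough to expose [n] digits of [z] and the first [n] digits of the [i]-th witness. *)
pose N := (n + \max_(k < n) (pickle (i, nat_of_ord k)).+1)%N.
have Dn : D N i n.
  split=> [|k kn]; first exact: leq_addr.
  rewrite (leq_trans _ (leq_addl _ _))//.
  exact: (leq_bigmax (F := fun k : 'I_n => (pickle (i, nat_of_ord k)).+1) (Ordinal kn)).
have := Hw N i I n; rewrite size_mkseq => /(_ Dn).
by rewrite nth_code// take_mkseq//; case: Dn.
Qed.

(** Analytic sets are not closed under complement, so the induction runs over sets that are analytic
    together with their complement; these form a sigma-algebra containing the generators. *)
Lemma measurable_analytic (B : set (X * baire)) : measurable B -> analytic B.
Proof.
move=> mB.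
suff : [set B | analytic B /\ analytic (~` B)] B by case.
have rect (C : set X) : measurable C -> analytic (fst @^-1` C).
  move=> mC; exists (fun _ _ => C); split => // x z.
  by split => [Cx|[w /(_ 0%N)]//]; exists id.
have Sig : sigma_algebra setT [set B : set (X * baire) | analytic B /\ analytic (~` B)].
  split => /=.
  - by split; [rewrite -(preimage_set0 fst)|rewrite setC0 -(preimage_setT fst)]; exact: rect.
  - by move=> C [C1 C2]; rewrite setTD setCK.
  - move=> F HF; split; first by apply: analytic_bigcup => i; have [] := HF i.
    by rewrite setC_bigcup; apply: analytic_bigcap => i; have [] := HF i.
apply: (smallest_sub Sig _ mB) => _ [|] [C mC <-]; rewrite setTI.
  by split; [|rewrite preimage_setC]; apply: rect; last exact: measurableC.
suff : [set C : set baire | analytic (snd @^-1` C) /\ analytic (~` (snd @^-1` C))] C by [].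
have Sig' : sigma_algebra setT
   [set C : set baire | analytic (snd @^-1` C) /\ analytic (~` (snd @^-1` C))].
  case: Sig => S0 SC SU; split => /=.
  - by rewrite preimage_set0.
  - by move=> D [D1 D2]; rewrite setTD preimage_setC setCK.
  - by move=> F HF; rewrite preimage_bigcup; exact: SU.
apply: (smallest_sub Sig' _ mC) => _ [i [j ->]] /=.
(* The scheme imposes nothing until the prefix reaches coordinate [i], then tests that
   coordinate. *)
have cyl (P : nat -> Prop) : analytic [set p : X * baire | P ((p.2 : nat -> nat) i)].
  exists (fun s _ => if (i < size s)%N then [set _ | P (nth 0%N s i)] else setT); split.
    move=> s _; case: ifP => // _.
    have [Ps|Ps] := pselect (P (nth 0%N s i)).
      by rewrite (_ : [set _ | _] = setT)//; apply/seteqP; split => // y _.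
    by rewrite (_ : [set _ | _] = set0)//; apply/seteqP; split => // y /Ps.
  move=> x z; split => [/= Pz|[w /(_ i.+1)]].
    by exists id => n; rewrite size_mkseq; case: ifPn => //= ni; rewrite nth_mkseq.
  by rewrite size_mkseq ltnSn/= nth_mkseq.
split; first exact: (cyl (fun n => n = j)).
exact: (cyl (fun n => n <> j)).
Qed.

(** The existential over [z] and the one over the witness merge into one over a branch of coded
    pairs. Numbers that code no pair decode to [(0, 0)], which is harmless: every branch still
    decodes to some [z] and [w]. *)
Lemma souslin_projection (B : set (X * baire)) : measurable B ->
  exists2 A : seq nat -> set X, (forall s, measurable (A s)) &
    [set x | exists z, B (x, z)] = souslin A.
Proof.
move=> /measurable_analytic[A [mA HA]].
pose dec n : nat * nat := odflt (0, 0)%N (unpickle n).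
exists (fun s => A [seq (dec i).1 | i <- s] [seq (dec i).2 | i <- s]) => //.
have dec_mkseq (f : nat -> nat) n (g : nat * nat -> nat) :
    [seq g (dec i) | i <- mkseq f n] = mkseq (fun i => g (dec (f i))) n.
  by rewrite /mkseq -map_comp.
apply/seteqP; split => x.
  move=> [z /HA[w Hw]]; exists (fun i => pickle (z i, w i)) => n.
  rewrite !dec_mkseq (@eq_mkseq _ _ z) 1?(@eq_mkseq _ (fun i => (dec _).2) w)//.
  - by move=> i; rewrite /dec pickleK.
  - by move=> i; rewrite /dec pickleK.
move=> [f Hf]; exists (fun i => (dec (f i)).1); apply/HA.
exists (fun i => (dec (f i)).2) => n; rewrite -!dec_mkseq; exact: Hf.
Qed.

Lemma measurable_projection (R : realType) (m : {finite_measure set X -> \bar R})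
    (B : set (X * baire)) : measurable B ->
  exists C D, [/\ measurable C, measurable D, C `<=` [set x | exists z, B (x, z)],
    [set x | exists z, B (x, z)] `<=` D & m (D `\` C) = 0%E].
Proof. by move=> /souslin_projection[A mA ->]; exact: souslin_sandwich. Qed.

End projection.

(** * Laws on the line and on strips *)

Section law.
Context d1 d2 (T1 : measurableType d1) (T2 : measurableType d2) (R : realType).
Variables (P : probability T1 R) (f : T1 -> T2).
Hypothesis mf : measurable_fun setT f.

Let F : {mfun T1 >-> T2} := mfun_Sub (mem_set mf).

Definition law : probability T2 R := distribution P F.

Lemma lawE A : law A = P (f @^-1` A).
Proof. by []. Qed.

Lemma integral_law (h : T2 -> \bar R) : measurable_fun setT h ->
  (forall y, 0 <= h y)%E -> (\int[law]_y h y = \int[P]_x h (f x))%E.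
Proof. by move=> mh h0; rewrite [LHS]ge0_integral_pushforward. Qed.

End law.

Section rational_rays.
Context (R : realType).

(** Rational endpoints make equality of two laws a countable condition, which is what lets the
    coupling constraint be measurable in the code. *)
Definition ratrays : set (set R) := [set A | exists q : rat, A = `]-oo, (ratr q : R)[%classic].

Lemma measurable_ratrays : (measurable : set (set R)) = <<s ratrays >>.
Proof.
apply/seteqP; split; last first.
  apply: smallest_sub; first exact: sigma_algebra_measurable.
  by move=> _ [q ->].
rewrite [X in X `<=` _](_ : _ = <<s @RGenInftyO.G R >>); last exact: RGenInftyO.measurableE.
apply: smallest_sub; first exact: smallest_sigma_algebra.
move=> _ [x ->].
rewrite (_ : `]-oo, x[%classic = \bigcup_(q in [set q : rat | ratr q < x]) `]-oo, ratr q[%classic).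
  rewrite bigcup_mkcond.
  have cq : countable [set: rat] by [].
  apply: (@countable_bigcupT_measurable _ (g_sigma_algebraType ratrays) _ _ cq) => q.
  case: ifP => _; last exact: sigma_algebra0.
  by apply: sub_sigma_algebra; exists q.
apply/seteqP; split => y /=.
  rewrite in_itv/= => /rat_in_itvoo[q]; rewrite in_itv/= => /andP[yq qx].
  by exists q => //=; rewrite in_itv.
by move=> [q /= qx]; rewrite !in_itv/= => /lt_trans; exact.
Qed.

Lemma setI_ratray (q q' : rat) : `]-oo, (ratr q : R)[%classic `&` `]-oo, ratr q'[%classic =
  `]-oo, ratr (Num.min q q')[%classic.
Proof.
apply/seteqP; split => y /=; rewrite !in_itv/=.
  by move=> [yq yq']; rewrite minEle; case: ifP.
by move=> /lt_le_trans h; split; apply: h; rewrite ler_rat ge_min lexx ?orbT.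
Qed.

Lemma ratrays_cover : \bigcup_(n : nat) `]-oo, (ratr n%:Q : R)[%classic = setT.
Proof.
apply/seteqP; split => // x _; exists (Num.trunc `|x|).+1 => //=.
rewrite in_itv/= ratr_nat; apply: (le_lt_trans (ler_norm x)); exact: truncnS_gt.
Qed.

Lemma ratrays_unique (m1 m2 : {finite_measure set R -> \bar R}) :
  (forall q : rat, m1 `]-oo, ratr q[%classic = m2 `]-oo, ratr q[%classic) ->
  forall A, measurable A -> m1 A = m2 A.
Proof.
move=> H A mA.
apply: (measure_unique ratrays (fun n : nat => `]-oo, (ratr n%:Q : R)[%classic)) => //.
- exact: measurable_ratrays.
- by move=> _ _ [q ->] [q' ->]; exists (Num.min q q'); exact: setI_ratray.
- by move=> n; exists n%:Q.
- exact: ratrays_cover.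
- by move=> _ [q ->]; exact: H.
- by move=> n; rewrite ltey_eq fin_num_measure.
Qed.

Context d (T : measurableType d).

Definition strips : set (set (T * R)) :=
  [set B | exists A (q : rat), measurable A /\ B = A `*` `]-oo, ratr q[%classic].

Lemma measurable_strips : (measurable : set (set (T * R))) = <<s strips >>.
Proof.
apply/seteqP; split; last first.
  apply: smallest_sub; first exact: sigma_algebra_measurable.
  by move=> _ [A [q [mA ->]]]; exact: measurableX.
pose S : measurableType _ := g_sigma_algebraType strips.
apply: smallest_sub; first exact: smallest_sigma_algebra.
move=> _ [|] [C mC <-]; rewrite setTI.
  rewrite (_ : fst @^-1` C = \bigcup_(n : nat) (C `*` `]-oo, (ratr n%:Q : R)[%classic)).
    apply: (@bigcupT_measurable _ S) => n.
    by apply: sub_sigma_algebra; exists C, n%:Q.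
  by rewrite -setX_bigcupr ratrays_cover setXT.
suff : [set C : set R | <<s strips >> ((snd : T * R -> R) @^-1` C)] C by [].
rewrite measurable_ratrays in mC; apply: (smallest_sub _ _ mC).
  split => /=.
  - by rewrite preimage_set0; exact: sigma_algebra0.
  - by move=> D HD; rewrite setTD preimage_setC; exact: (@measurableC _ S).
  - by move=> F HF; rewrite preimage_bigcup; exact: (@bigcupT_measurable _ S).
move=> _ [q ->] /=; apply: sub_sigma_algebra; exists setT, q; split => //.
by rewrite setTX.
Qed.

Lemma strips_unique (m1 m2 : {finite_measure set (T * R)%type -> \bar R}) :
  (forall A (q : rat), measurable A ->
     m1 (A `*` `]-oo, ratr q[%classic) = m2 (A `*` `]-oo, ratr q[%classic)) ->
  forall A, measurable A -> m1 A = m2 A.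
Proof.
move=> H A mA.
apply: (measure_unique strips (fun n : nat => setT `*` `]-oo, (ratr n%:Q : R)[%classic)) => //.
- exact: measurable_strips.
- move=> _ _ [B [q [mB ->]]] [B' [q' [mB' ->]]].
  exists (B `&` B'), (Num.min q q'); split; first exact: measurableI.
  by rewrite -setI_ratray setXI.
- by move=> n; exists setT, n%:Q.
- by rewrite -setX_bigcupr ratrays_cover setXTT.
- by move=> _ [B [q [mB ->]]]; exact: H.
- by move=> n; rewrite ltey_eq fin_num_measure//; exact: measurableX.
Qed.

End rational_rays.

(** * Quantile functions *)

Section indexed_infimum.
Context d (X : measurableType d) (R : realType) (I : countType).
Variables (v : I -> R) (A : I -> set X).

(** The common form of quantiles, decoded reals and measurable minorants below: strict sublevel sets
    are countable unions of the [A i]. *)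
Definition index_inf (x : X) : \bar R := ereal_inf [set (v i)%:E | i in [set i | A i x]].

Lemma index_inf_lt x y :
  (index_inf x < y)%E <-> exists2 i, A i x & ((v i)%:E < y)%E.
Proof.
split; first by move=> /ereal_inf_lt[_ [i Ai <-] iy]; exists i.
by move=> [i Ai iy]; apply: le_lt_trans iy; apply: ereal_inf_lbound; exists i.
Qed.

Lemma measurable_index_inf : (forall i, measurable (A i)) ->
  measurable_fun setT index_inf.
Proof.
move=> mA _; apply: (measurability _ (ErealGenInftyO.measurableE R)) => // _ [_ [y ->] <-].
rewrite setTI (_ : _ @^-1` _ = \bigcup_(i in [set i | v i < y]) A i).
  rewrite bigcup_mkcond; apply: countable_bigcupT_measurable => // i.
  by case: ifP.
apply/seteqP; split => x /=; rewrite in_itv/=.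
  by move=> /index_inf_lt[i Ai]; rewrite lte_fin => iy; exists i.
by move=> [i /= iy Ai]; apply/index_inf_lt; exists i; rewrite ?lte_fin.
Qed.

End indexed_infimum.

Section quantile.
Context d (T : measurableType d) (R : realType).
Variable a : rat -> T -> R.
Hypothesis ma : forall q, measurable_fun setT (a q).

(** The generalised inverse in [u] of the conditional distribution function [q |-> a q t], known
    only at rationals. It may be infinite, and [quantile] then takes the value 0. *)
Definition equantile : T * R -> \bar R :=
  index_inf (fun q => ratr q) (fun q => [set p | p.2 <= a q p.1]).

Definition quantile (p : T * R) : R := fine (equantile p).

Lemma measurable_equantile : measurable_fun setT equantile.
Proof.
apply: measurable_index_inf => q.
rewrite -[X in measurable X]setTI; apply: measurable_fun_le => //.
by apply: measurableT_comp => //; exact: ma.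
Qed.

Lemma measurable_quantile : measurable_fun setT quantile.
Proof. by apply: measurableT_comp; [exact: fine_measurable|exact: measurable_equantile]. Qed.

End quantile.

Section uniform.
Context (R : realType).

(* [uniform_prob] lives on [measurableTypeR R], whose display is not that of [R]. *)
Let measurable_to_R : measurable_fun setT (fun x : measurableTypeR R => (x : R)).
Proof. exact: measurable_id. Qed.

Definition unif : probability R R := law (uniform_prob (@ltr01 R)) measurable_to_R.

Lemma unif_ray (x : R) : 0 <= x <= 1 -> unif `]-oo, x]%classic = x%:E.
Proof.
move=> /andP[x0 x1]; rewrite /unif lawE [LHS]integral_uniform_pdf.
rewrite (_ : _ `&` _ = `[0, x]%classic); last first.
  apply/seteqP; split => y /=; rewrite !in_itv/=; first by move=> [-> /andP[-> _]].
  by move=> /andP[y0 yx]; rewrite yx y0 (le_trans yx x1).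
rewrite (eq_integral (fun=> 1%:E)); last first.
  move=> y; rewrite inE/= in_itv/= /uniform_pdf => /andP[-> yx].
  by rewrite (le_trans yx x1) subr0 invr1.
rewrite integral_cst//= mul1e lebesgue_measure_itv/= lte_fin.
by move: x0; rewrite le_eqVlt => /orP[/eqP <-|x0]; rewrite ?ltxx ?x0 ?sube0.
Qed.

End uniform.

Lemma rat_seq_below (R : realType) (x : R) : exists q : nat -> rat,
  [/\ nondecreasing_seq q, forall n, ratr (q n) < x &
   forall r : rat, ratr r < x -> exists n, r <= q n].
Proof.
(* Consecutive disjoint intervals accumulating at [x] force the chosen rationals to increase. *)
have H (n : nat) : exists q : rat,
    ratr q \in `](x - n.+1%:R^-1), (x - n.+2%:R^-1)[.
  apply: rat_in_itvoo; rewrite ltrD2l ltrN2 ltf_pV2 ?posrE ?ltr0n//.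
  by rewrite ltr_nat.
have [q Hq] := choice H.
have q_lt n : ratr (q n) < x.
  have := Hq n; rewrite in_itv/= => /andP[_ /lt_trans]; apply.
  by rewrite ltrBlDr ltrDl invr_gt0 ltr0n.
exists q; split => //.
- apply/nondecreasing_seqP => n; rewrite -(ler_rat R).
  have := Hq n; rewrite in_itv/= => /andP[_ /ltW /le_trans]; apply.
  by have := Hq n.+1; rewrite in_itv/= => /andP[/ltW].
- move=> r rx.
  have xr0 : 0 < x - ratr r by rewrite subr_gt0.
  have [n _ /(_ n (leqnn _)) /= nxr] := near_infty_natSinv_lt (PosNum xr0).
  exists n; rewrite -(ler_rat R); have := Hq n; rewrite in_itv/= => /andP[+ _].
  move=> /ltW; apply: le_trans.
  by rewrite lerBrDr -lerBrDl ltW.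
Qed.

Section quantile_law.
Context d (T : measurableType d) (R : realType).
Variable a : rat -> T -> R.
Hypothesis ma : forall q, measurable_fun setT (a q).
Hypothesis a01 : forall q t, 0 <= a q t <= 1.
Hypothesis nda : forall t q q', q <= q' -> a q t <= a q' t.
Variables (eta : probability T R) (P : probability (T * R)%type R).
Hypothesis aP : forall q A, measurable A ->
  (\int[eta]_(t in A) (a q t)%:E)%E = P (A `*` `]-oo, ratr q]%classic).
Local Open Scope ereal_scope.

Let mu : probability (T * R)%type R := eta \x unif R.

Let measurable_below A q : measurable A ->
  measurable ((A `*` setT) `&` [set p : T * R | (p.2 <= a q p.1)%R]).
Proof.
move=> mA; apply: measurable_fun_le.
- exact: measurableX.
- exact: measurable_funTS.
- apply: measurable_funTS; exact: (measurableT_comp (ma q)).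
Qed.

Let below_law A q : measurable A ->
  mu ((A `*` setT) `&` [set p : T * R | (p.2 <= a q p.1)%R]) =
  P (A `*` `]-oo, ratr q]%classic).
Proof.
move=> mA; rewrite -aP// /mu/= /product_measure1 [RHS]integral_mkcond.
apply: eq_integral => t _ /=; rewrite patchE; case: ifPn => [tA|tA].
  rewrite -unif_ray//; congr (unif R _); apply/seteqP; split => u /=.
    by rewrite /xsection/= !inE => -[[_ _]].
  by rewrite in_itv/= => uq; rewrite /xsection/= inE; split => //; split => //; exact: set_mem.
rewrite [X in unif R X](_ : _ = set0) ?measure0//; apply/seteqP; split => // u.
by rewrite /xsection/= inE => -[[/= /mem_set]]; rewrite (negbTE tA).
Qed.

(** No right-continuity of [a] is assumed. The strict event is the increasing union of the events
    [u <= a q t] over rationals [q < x]; for each of them the uniform law gives conditional mass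
    [a q t], and the closed rays up to [q] exhaust the open ray. *)
Lemma equantile_law A (x : R) : measurable A ->
  mu ((A `*` setT) `&` [set p | equantile a p < x%:E]) = P (A `*` `]-oo, x[%classic).
Proof.
move=> mA; have [q [ndq qx qcof]] := rat_seq_below x.
pose E n := (A `*` setT) `&` [set p : T * R | (p.2 <= a (q n) p.1)%R].
pose F n := A `*` `]-oo, (ratr (q n) : R)]%classic.
have mE n : measurable (E n) by exact: measurable_below.
have mF n : measurable (F n) by exact: measurableX.
have ndE : nondecreasing_seq E.
  move=> n m nm; apply/subsetPset => p [pA /= pq]; split => //=.
  by apply: (le_trans pq); apply: nda; exact: ndq.
have ndF : nondecreasing_seq F.
  move=> n m nm; apply/subsetPset => p [pA /=]; rewrite in_itv/= => pq; split => //=.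
  by rewrite in_itv/= (le_trans pq)// ler_rat; exact: ndq.
have -> : (A `*` setT) `&` [set p | equantile a p < x%:E] = \bigcup_n E n.
  apply/seteqP; split => p.
    move=> [pA /= /index_inf_lt[r /= pr]]; rewrite lte_fin => /qcof[n rq].
    by exists n => //; split => //=; apply: (le_trans pr); exact: nda.
  by move=> [n _ [pA /= pq]]; split => //=; apply/index_inf_lt; exists (q n); rewrite ?lte_fin.
have -> : A `*` `]-oo, x[%classic = \bigcup_n F n.
  apply/seteqP; split => p.
    move=> [pA /=]; rewrite in_itv/= => /rat_in_itvoo[r]; rewrite in_itv/=.
    move=> /andP[pr /qcof[n rq]]; exists n => //; split => //=.
    by rewrite in_itv/= (le_trans (ltW pr))// ler_rat.
  move=> [n _ [pA /=]]; rewrite in_itv/= => pq; split => //=.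
  by rewrite in_itv/= (le_lt_trans pq).
have cE := nondecreasing_cvg_mu (mu := mu) mE (bigcupT_measurable _ mE) ndE.
have cF := nondecreasing_cvg_mu (mu := P) mF (bigcupT_measurable _ mF) ndF.
rewrite -(cvg_lim _ cE)// -(cvg_lim _ cF)//; congr (limn _); apply/funext => n /=.
exact: below_law.
Qed.

Let measurable_equantile_preimage (B : set (\bar R)) : measurable B ->
  measurable (equantile a @^-1` B).
Proof. by move=> mB; rewrite -[X in measurable X]setTI; exact: measurable_equantile. Qed.

(** The limits of [a] at both infinities are controlled only on average: the masses of the strips
    below [-n] and below [n] under [P] tend to 0 and 1. *)
Lemma equantile_fin_num : mu [set p | equantile a p \isn't a fin_num] = 0.
Proof.
pose F (n : nat) : set (T * R) := setT `*` `]-oo, (- n%:R : R)%R[%classic.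
pose G (n : nat) : set (T * R) := setT `*` `]-oo, (n%:R : R)%R[%classic.
have mF n : measurable (F n) by exact: measurableX.
have mG n : measurable (G n) by exact: measurableX.
have mlt (x : \bar R) : measurable [set p | equantile a p < x].
  rewrite (_ : [set p | _] = equantile a @^-1` [set y | y < x])//.
  apply: measurable_equantile_preimage.
  by rewrite -[X in measurable X]setTI; exact: emeasurable_fun_infty_o.
have mNy : measurable [set p | equantile a p = -oo].
  by apply: (measurable_equantile_preimage (emeasurable_set1 -oo)).
have my : measurable [set p | equantile a p = +oo].
  by apply: (measurable_equantile_preimage (emeasurable_set1 +oo)).
have Ny : mu [set p | equantile a p = -oo] = 0.
  have cF : P \o F @ \oo --> P (\bigcap_n F n).
    apply: nonincreasing_cvg_mu => //.
    - by rewrite ltey_eq fin_num_measure.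
    - exact: bigcapT_measurable.
    - move=> n m nm; apply/subsetPset => p [_ /=]; rewrite !in_itv/= => pm; split => //=.
      by rewrite in_itv/= (lt_le_trans pm)// lerN2 ler_nat.
  have F0 : \bigcap_n F n = set0.
    apply/seteqP; split => // p /(_ (Num.trunc `|p.2|).+1 I)[_ /=]; rewrite in_itv/=.
    rewrite ltrNr => /(lt_trans (truncnS_gt _)); rewrite -normrN => /lt_geF.
    by rewrite ler_norm.
  rewrite F0 measure0 in cF.
  apply/le_anti/andP; split => //.
  rewrite -[leRHS](cvg_lim _ cF)//; apply: lime_ge; first by apply/cvg_ex; eexists; exact: cF.
  apply: nearW => n /=; rewrite -equantile_law//; apply: le_measure; rewrite ?inE//.
    by apply: measurableI => //; exact: measurableX.
  by move=> p /= ->; split => //; exact: ltNyr.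
have y : mu [set p | equantile a p = +oo] = 0.
  have cG : P \o G @ \oo --> P (\bigcup_n G n).
    apply: nondecreasing_cvg_mu => //; first exact: bigcupT_measurable.
    move=> n m nm; apply/subsetPset => p [_ /=]; rewrite !in_itv/= => pm; split => //=.
    by rewrite in_itv/= (lt_le_trans pm)// ler_nat.
  have GT : \bigcup_n G n = setT.
    apply/seteqP; split => // p _; exists (Num.trunc `|p.2|).+1 => //; split => //=.
    by rewrite in_itv/= (le_lt_trans (ler_norm _))// truncnS_gt.
  rewrite GT probability_setT in cG.
  have lty1 : mu [set p | equantile a p < +oo] = 1.
    apply/le_anti/andP; split; first exact: probability_le1.
    rewrite -[leLHS](cvg_lim _ cG)//; apply: lime_le; first by apply/cvg_ex; eexists; exact: cG.
    apply: nearW => n /=; rewrite -equantile_law//; apply: le_measure; rewrite ?inE//.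
      by apply: measurableI => //; exact: measurableX.
    by move=> p [_ /= pn]; rewrite /= (lt_trans pn)// ltry.
  rewrite (_ : [set p | _ = +oo] = ~` [set p | equantile a p < +oo]); last first.
    by apply/seteqP; split => p /=; [move=> ->; rewrite ltxx|move=> /negP; rewrite -leNgt leye_eq => /eqP].
  by rewrite probability_setC// lty1 subee.
rewrite (_ : [set p | _] = [set p | equantile a p = -oo] `|` [set p | equantile a p = +oo]).
  by apply: null_set_setU.
apply/seteqP; split => p /=; last by case => ->.
by case: (equantile a p) => //; [right|left].
Qed.

Lemma quantile_law B : measurable B ->
  mu ((fun p => (p.1, quantile a p)) @^-1` B) = P B.
Proof.
have mq : measurable_fun setT (fun p : T * R => (p.1, quantile a p)).
  by apply: measurable_fun_pair => //; exact: measurable_quantile.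
rewrite -(lawE mu mq).
apply: (strips_unique (m1 := law mu mq) (m2 := P)) => A q mA.
suff E : mu ((fun p => (p.1, quantile a p)) @^-1` (A `*` `]-oo, ratr q[%classic)) =
    mu ((A `*` setT) `&` [set p | equantile a p < (ratr q)%:E]).
  exact: (eq_trans E (equantile_law _ mA)).
have mI : measurable ((A `*` setT) `&` [set p | equantile a p < (ratr q)%:E]).
  apply: measurableI; first exact: measurableX.
  apply: (measurable_equantile_preimage (B := [set y | y < (ratr q)%:E])).
  by rewrite -[X in measurable X]setTI; exact: emeasurable_fun_infty_o.
have mN : measurable [set p | equantile a p \isn't a fin_num].
  rewrite (_ : [set _ | _] = equantile a @^-1` (~` [set y | y \is a fin_num])).
    apply: measurable_equantile_preimage; apply: measurableC.
    by rewrite -[X in measurable X]setTI; exact: emeasurable_fin_num.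
  by apply/seteqP; split => p /= /negP.
apply/le_anti/andP; split.
  rewrite -[leRHS](measureU0 mI mN equantile_fin_num).
  apply: le_measure; rewrite ?inE; [|exact: measurableU|].
    by rewrite -[X in measurable X]setTI; apply: mq => //; exact: measurableX.
  move=> p [/= pA]; rewrite in_itv/= => pq.
  have [pf|pf] := boolP (equantile a p \is a fin_num); last by right.
  by left; split => //=; rewrite -(fineK pf) lte_fin.
rewrite -[leRHS](measureU0 _ mN equantile_fin_num).
  apply: le_measure; rewrite ?inE//.
    apply: measurableU => //.
    by rewrite -[X in measurable X]setTI; apply: mq => //; exact: measurableX.
  move=> p [[pA _] /= pq].
  have [pf|pf] := boolP (equantile a p \is a fin_num); last by right.
  by left; split => //=; rewrite in_itv/= -lte_fin fineK.
by rewrite -[X in measurable X]setTI; apply: mq => //; exact: measurableX.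
Qed.

End quantile_law.

(** * Disintegration and gluing *)

Lemma null_bigcup d (T : measurableType d) (R : realType) (I : countType)
    (m : {measure set T -> \bar R}) (F : I -> set T) :
  (forall i, measurable (F i)) -> (forall i, m (F i) = 0%E) -> m (\bigcup_i F i) = 0%E.
Proof.
move=> mF F0; pose G n := if @unpickle I n is Some i then F i else set0.
have mG n : measurable (G n) by rewrite /G; case: unpickle.
have G0 n : m (G n) = 0%E by rewrite /G; case: unpickle => //; rewrite measure0.
have -> : \bigcup_i F i = \bigcup_n G n.
  apply/seteqP; split => t; first by move=> [i _ Fi]; exists (pickle i) => //; rewrite /G pickleK.
  by move=> [n _]; rewrite /G; case: unpickle => // i Fi; exists i.
apply/negligibleP; first exact: bigcupT_measurable.
by apply: negligible_bigcup => n; apply/negligibleP => //; exact: G0.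
Qed.

(** On the set where [g < f] both functions have equal integrals over every measurable subset, hence
    agree almost everywhere there, which leaves only a null set. *)
Lemma integral_le_null d (T : measurableType d) (R : realType)
    (m : {measure set T -> \bar R}) (f g : T -> \bar R) :
  m.-integrable setT f -> m.-integrable setT g ->
  (forall A, measurable A -> \int[m]_(t in A) f t <= \int[m]_(t in A) g t)%E ->
  m [set t | (g t < f t)%E] = 0%E.
Proof.
move=> fi gi fg.
have mf := measurable_int _ fi; have mg := measurable_int _ gi.
have mA : measurable [set t | (g t < f t)%E].
  by rewrite -[X in measurable X]setTI; exact: measurable_lte.
have [N [mN N0 AN]] : ae_eq m [set t | (g t < f t)%E] f g.
  apply: integral_ae_eq => //.
  - exact: integrableS fi.
  - exact: measurable_funTS.
  - move=> E EA mE; apply/le_anti/andP; split; first exact: fg.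
    apply: le_integral => //; [exact: integrableS gi|exact: integrableS fi|].
    by move=> t; rewrite inE => /EA /= /ltW.
apply: (@subset_measure0 _ _ _ m _ N) => // t /= gf.
by apply: AN => /= /(_ gf) E; move: gf; rewrite E ltxx.
Qed.

Section disintegration.
Context d (T : measurableType d) (R : realType).
Variable P : probability (T * R)%type R.
Local Open Scope ereal_scope.

(** Its density with respect to the first marginal of [P] is the conditional distribution function
    at [q]. *)
Definition slice (q : rat) (A : set T) : \bar R := P (A `*` `]-oo, (ratr q : R)]%classic).

Let slice0 q : slice q set0 = 0.
Proof. by rewrite /slice set0X measure0. Qed.

Let slice_ge0 q A : 0 <= slice q A.
Proof. exact: measure_ge0. Qed.

Let slice_sigma_additive q : semi_sigma_additive (slice q).
Proof.
move=> F mF tF mUF; rewrite /slice setX_bigcupl.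
apply: measure_semi_sigma_additive.
- by move=> n; exact: measurableX.
- move/trivIsetP : tF => tF; apply/trivIsetP => i j _ _ ij; rewrite -setXI tF// set0X//.
- by apply: bigcupT_measurable => n; exact: measurableX.
Qed.

HB.instance Definition _ q := isMeasure.Build _ _ _ (slice q)
  (slice0 q) (slice_ge0 q) (@slice_sigma_additive q).

Let slice_fin q : fin_num_fun (slice q).
Proof. by move=> A mA; apply: fin_num_measure; exact: measurableX. Qed.

HB.instance Definition _ q := Measure_isFinite.Build _ _ _ (slice q) (slice_fin q).

Let eta : probability T R := law P measurable_fst.

Let etaE A : eta A = P (A `*` setT).
Proof. by rewrite /eta lawE setXT. Qed.

Lemma slice_dominated q : slice q `<< eta.
Proof.
apply/null_content_dominatesP => A mA A0; apply/eqP; rewrite -measure_le0.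
rewrite -A0 [X in _ <= X](etaE A); apply: le_measure; rewrite ?inE//.
- exact: measurableX.
- exact: measurableX.
- by move=> p [].
Qed.

Lemma conditional_cdf : exists a : rat -> T -> R,
  [/\ forall q, measurable_fun setT (a q),
      forall q t, (0 <= a q t <= 1)%R,
      forall t q q', (q <= q')%R -> (a q t <= a q' t)%R &
      forall q A, measurable A ->
        \int[eta]_(t in A) (a q t)%:E = P (A `*` `]-oo, ratr q]%classic)].
Proof.
have /choice[f Hf] : forall q, exists g : T -> \bar R, [/\ forall t, 0 <= g t,
    eta.-integrable setT g &
    forall A, measurable A -> slice q A = \int[eta]_(t in A) g t].
  by move=> q; exact: radon_nikodym_finite (slice_dominated q).
have f0 q t : 0 <= f q t by have [] := Hf q.
have fi q : eta.-integrable setT (f q) by have [] := Hf q.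
have fE q A : measurable A -> \int[eta]_(t in A) f q t = slice q A.
  by move=> mA; have [_ _ ->] := Hf q.
have mf q : measurable_fun setT (f q) := measurable_int _ (fi q).
pose N1 q := [set t | 1 < f q t].
pose N2 (p : rat * rat) := if (p.1 <= p.2)%R then [set t | f p.2 t < f p.1 t] else set0.
have mN1 q : measurable (N1 q).
  by rewrite -[X in measurable X]setTI; exact: measurable_lte.
have mN2 p : measurable (N2 p).
  rewrite /N2; case: ifP => // _.
  by rewrite -[X in measurable X]setTI; exact: measurable_lte.
have N1_0 q : eta (N1 q) = 0.
  apply: (integral_le_null (f := f q) (g := cst 1)) => //.
    exact: finite_measure_integrable_cst.
  move=> A mA; rewrite fE// integral_cst// mul1e [leRHS]etaE.
  by apply: le_measure; rewrite ?inE//; [exact: measurableX|exact: measurableX|move=> p []].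
have N2_0 p : eta (N2 p) = 0.
  rewrite /N2; case: ifPn => [qq'|_]; last by rewrite measure0.
  apply: integral_le_null => // A mA; rewrite !fE//.
  apply: le_measure; rewrite ?inE//; [exact: measurableX|exact: measurableX|].
  by move=> r [rA /=]; rewrite in_itv/= => rq; split => //=; rewrite in_itv/= (le_trans rq)// ler_rat.
pose N := \bigcup_q N1 q `|` \bigcup_p N2 p.
have mU1 : measurable (\bigcup_q N1 q) by exact: countable_bigcupT_measurable.
have mU2 : measurable (\bigcup_p N2 p) by exact: countable_bigcupT_measurable.
have mN : measurable N by exact: measurableU.
have N0 : eta N = 0 by apply: null_set_setU => //; exact: null_bigcup.
(* The densities are bounded by 1 and monotone in [q] only almost everywhere. As [q] is rational the
   bad points form one null set, where the constant 0 restores both properties. *)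
pose a q t := if t \in N then 0%R else fine (f q t).
have f_le1 q t : t \notin N -> f q t <= 1.
  rewrite notin_setE => Nt; rewrite leNgt; apply/negP => ft.
  by apply: Nt; left; exists q.
have f_fin q t : t \notin N -> f q t \is a fin_num.
  by move=> /f_le1 ft; rewrite ge0_fin_numE// (le_lt_trans (ft q))// ltry.
have ma q : measurable_fun setT (a q).
  apply: measurable_fun_ifT => //.
    by apply: (measurable_fun_bool true); rewrite setTI (_ : _ @^-1` _ = N)//;
      apply/seteqP; split => t /=; [move/set_mem|move/mem_set].
  by apply: measurableT_comp => //; exact: fine_measurable.
exists a; split => //.
- move=> q t; rewrite /a; case: ifPn => [_|tN]; first by rewrite lexx ler01.
  by rewrite fine_ge0//= -lee_fin fineK ?f_fin ?f_le1.
- move=> t q q' qq'; rewrite /a; case: ifPn => // tN.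
  apply: fine_le; rewrite ?f_fin//.
  rewrite leNgt; apply/negP => ff; move: tN; rewrite notin_setE; apply.
  by right; exists (q, q') => //; rewrite /N2/= qq'.
- move=> q A mA; rewrite -/(slice q A) -fE//; apply: ae_eq_integral => //.
  + exact/measurable_EFinP/measurable_funTS.
  + exact: measurable_funTS.
  exists N; split => // t /= /not_implyP[_ /eqP]; rewrite /a; case: ifPn => [|tN].
    by rewrite in_setE.
  by rewrite fineK ?eqxx ?f_fin.
Qed.

(** The second coordinate is regenerated from the first and an independent uniform variable, through
    the conditional quantile. *)
Lemma noise_outsourcing : exists2 f : T * R -> R, measurable_fun setT f &
  forall B, measurable B ->
    (law P measurable_fst \x unif R) ((fun p => (p.1, f p)) @^-1` B) = P B.
Proof.
have [a [ma a01 nda aP]] := conditional_cdf.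
exists (quantile a); first exact: measurable_quantile.
by move=> B mB; exact: quantile_law.
Qed.

End disintegration.

Section gluing.
Context (R : realType) (P Q : probability (R * R)%type R).
Hypothesis PQ : forall A, measurable A -> P (snd @^-1` A) = Q (fst @^-1` A).
Local Open Scope ereal_scope.

(** The outer coordinates are made conditionally independent given the shared one: each is
    regenerated from it with its own uniform variable. [P] is swapped first because the conditioning
    is on the first coordinate. *)
Lemma gluing : exists G : probability (R * R * R)%type R,
  (forall B, measurable B -> G ((fun x => (x.1.1, x.1.2)) @^-1` B) = P B) /\
  (forall B, measurable B -> G ((fun x => (x.1.2, x.2)) @^-1` B) = Q B).
Proof.
have msw : measurable_fun setT (fun p : R * R => (p.2, p.1)).
  exact: measurable_fun_pair.
pose P' := law P msw.
have [f mf Hf] := noise_outsourcing P'.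
have [g mg Hg] := noise_outsourcing Q.
pose eta := law P' measurable_fst.
have etaE A : measurable A -> law Q measurable_fst A = eta A.
  by move=> mA; exact: (esym (PQ mA)).
pose mu : probability (R * R * R)%type R := (eta \x unif R) \x unif R.
pose F (w : R * R * R) : R * R * R := ((f w.1, w.1.1), g (w.1.1, w.2)).
have mF : measurable_fun setT F.
  apply: measurable_fun_pair.
    apply: measurable_fun_pair; first exact: measurableT_comp.
    by apply: (measurableT_comp measurable_fst).
  apply: measurableT_comp => //; apply: measurable_fun_pair => //.
  exact: (measurableT_comp measurable_fst).
have mpf : measurable_fun setT (fun p : R * R => (p.1, f p)) by exact: measurable_fun_pair.
have mpg : measurable_fun setT (fun p : R * R => (p.1, g p)) by exact: measurable_fun_pair.
exists (law mu mF); split => B mB; rewrite lawE.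
  have mB' : measurable ((fun p : R * R => (p.2, p.1)) @^-1` B).
    by rewrite -[X in measurable X]setTI; exact: (msw measurableT _ mB).
  have mC : measurable ((fun p : R * R => (p.1, f p)) @^-1` ((fun p : R * R => (p.2, p.1)) @^-1` B)).
    rewrite -[X in measurable X]setTI.
    exact: (mpf measurableT _ mB').
  transitivity (P' ((fun p : R * R => (p.2, p.1)) @^-1` B)); last first.
    by rewrite lawE; congr (P _); apply/seteqP; split => -[].
  rewrite -Hf//.
  rewrite (_ : _ @^-1` _ = ((fun p : R * R => (p.1, f p)) @^-1`
    ((fun p : R * R => (p.2, p.1)) @^-1` B)) `*` setT).
    by rewrite /mu/= product_measure1E// [X in _ * X]probability_setT mule1.
  by apply/seteqP; split => w /=; [split|case].
have mC : measurable ((fun p : R * R => (p.1, g p)) @^-1` B).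
  rewrite -[X in measurable X]setTI.
  exact: (mpg measurableT _ mB).
rewrite -Hg//.
transitivity ((eta \x unif R) ((fun p : R * R => (p.1, g p)) @^-1` B)); last first.
  rewrite /product_measure1; apply: eq_measure_integral => A mA _; symmetry; exact: etaE.
(* The conditional mass of [B] does not involve the noise that generates the left coordinate, so
   that noise integrates out to 1. *)
pose h t := unif R (xsection ((fun p : R * R => (p.1, g p)) @^-1` B) t).
have mh : measurable_fun setT h by exact: measurable_fun_xsection.
transitivity (\int[eta \x unif R]_p h p.1).
  rewrite /mu/= {1}/product_measure1; apply: eq_integral => p _ /=.
  by congr (unif R _); apply/seteqP; split => u; rewrite /xsection/= !inE.
rewrite fubini_tonelli1//; last exact: (measurableT_comp mh).
rewrite /fubini_F /product_measure1; apply: eq_integral => t _ /=.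
by rewrite integral_cst// [X in _ * X]probability_setT mule1.
Qed.
End gluing.

(** * Coding laws on the plane *)

Section bit_expansion.
Context (R : realType).
Implicit Types (b : nat -> bool) (s : R).

(* In base 3 the digits 0 and 1 determine the expansion: no carries. *)
Definition bit_term b n : R := (b n)%:R * 3^-1 ^+ n.

Definition bit_sum b : R := limn (series (bit_term b)).

Let third01 : `|3^-1 : R| < 1.
Proof. by rewrite ger0_norm ?invr_ge0// invf_lt1// ltr1n. Qed.

Lemma cvg_bit_sum b : series (bit_term b) @ \oo --> bit_sum b.
Proof.
apply: (series_le_cvg _ _ _ (is_cvg_geometric_series third01 (a := 1))) => n.
- by rewrite /bit_term mulr_ge0// exprn_ge0// invr_ge0.
- by rewrite /geometric/= mul1r exprn_ge0// invr_ge0.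
- by rewrite /bit_term /geometric/= mul1r ler_piMl ?exprn_ge0 ?invr_ge0//; case: (b n).
Qed.

Lemma bit_sum_ge0 b : 0 <= bit_sum b.
Proof.
apply: limr_ge; first by apply/cvg_ex; eexists; exact: cvg_bit_sum.
by apply: nearW => n; rewrite /series/= sumr_ge0// => i _; rewrite /bit_term mulr_ge0// exprn_ge0// invr_ge0.
Qed.

Lemma bit_sum_rec b : bit_sum b = (b 0%N)%:R + 3^-1 * bit_sum (b \o succn).
Proof.
have h := @cvg_bit_sum (b \o succn).
have h1 : (b 0%N)%:R + 3^-1 * series (bit_term (b \o succn)) n
    @[n --> \oo] --> (b 0%N)%:R + 3^-1 * bit_sum (b \o succn).
  by apply: cvgD; [exact: cvg_cst|exact: cvgMr].
have h2 : series (bit_term b) n.+1 @[n --> \oo] --> bit_sum b.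
  by rewrite cvg_shiftS; exact: cvg_bit_sum.
apply: (cvg_unique _ h2) => //; apply: cvg_trans h1.
apply: near_eq_cvg; apply: nearW => n; rewrite /series/= big_nat_recl//= [bit_term b 0]/bit_term expr0 mulr1.
congr (_ + _); rewrite mulr_sumr; apply: eq_bigr => i _.
by rewrite /bit_term exprS mulrCA.
Qed.

Lemma bit_sum_le b : bit_sum b <= 3 / 2.
Proof.
rewrite /bit_sum (_ : 3 / 2 = 1 * (1 - 3^-1)^-1 :> R); last by field.
rewrite -(cvg_lim _ (cvg_geometric_series (a := 1) third01))//.
apply: ler_lim.
- by apply/cvg_ex; eexists; exact: cvg_bit_sum.
- exact: is_cvg_geometric_series.
- apply: nearW => n; apply: ler_sum => i _.
  by rewrite /bit_term /geometric/= mul1r ler_piMl ?exprn_ge0 ?invr_ge0//; case: (b i).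
Qed.

Definition bit_rest s : R := 3 * (s - (1 <= s)%R%:R).

(** The digits after the first contribute at most [3^-1 * (3 / 2) = 1 / 2 < 1], so the threshold 1
    reveals the leading digit. *)
Lemma bit0E b : (1 <= bit_sum b) = b 0%N.
Proof.
rewrite bit_sum_rec; have := bit_sum_ge0 (b \o succn); have := bit_sum_le (b \o succn).
set s := bit_sum _; case: (b 0%N) => /= s1 s0.
  by rewrite lerDl mulr_ge0.
by rewrite add0r; apply/negbTE; rewrite -ltNge; lra.
Qed.

Lemma bit_restE b : bit_rest (bit_sum b) = bit_sum (b \o succn).
Proof.
by rewrite /bit_rest bit0E bit_sum_rec addrAC subrr add0r mulrA divff// mul1r.
Qed.

Definition bit n s : bool := 1 <= iter n bit_rest s.

Lemma bitE n b : bit n (bit_sum b) = b n.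
Proof.
rewrite /bit; elim: n b => [|n IH] b /=; first exact: bit0E.
by rewrite -iterS iterSr bit_restE IH.
Qed.

Lemma measurable_bit n : measurable [set s | bit n s].
Proof.
have mr : measurable_fun setT bit_rest.
  apply: measurable_funM => //; apply: measurable_funB => //.
  rewrite (_ : (fun s => _) = fun s : R => if 1 <= s then 1 else 0); last first.
    by apply/funext => s; case: (1 <= s).
  by apply: measurable_fun_ifT => //; exact: measurable_fun_ler.
have mi : measurable_fun setT (iter n bit_rest).
  by elim: n => [|n IH] /=; [exact: measurable_id|exact: (measurableT_comp mr)].
rewrite -[X in measurable X]setTI; apply: measurable_fun_le => //.
Qed.

End bit_expansion.

(** * A measurable embedding of the plane into the line, with a measurable left inverse *)

Section plane_embedding.
Context (R : realType).

Definition nth_rat (n : nat) : rat := odflt 0 (unpickle n).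

(** Even bits record the rationals above the first coordinate and odd bits those above the second;
    each coordinate is recovered as the infimum of its recorded rationals. *)
Definition plane_bits (p : R * R) (n : nat) : bool :=
  if odd n then p.2 < ratr (nth_rat n./2) else p.1 < ratr (nth_rat n./2).

Definition embed_plane (p : R * R) : R := bit_sum R (plane_bits p).

Definition ecut (c : nat -> nat) : R -> \bar R :=
  index_inf (fun n => ratr (nth_rat n)) (fun n => [set s | bit (c n) s]).

Definition retract_plane (s : R) : R * R :=
  (fine (ecut double s), fine (ecut (succn \o double) s)).

Lemma embed_planeK : cancel embed_plane retract_plane.
Proof.
have infE (x : R) : ereal_inf [set (ratr (nth_rat n))%:E | n in [set n | x < ratr (nth_rat n)]] = x%:E.
  apply/le_anti/andP; split; last first.
    by apply: le_ereal_inf_tmp => _ [n /= xn <-]; rewrite lee_fin ltW.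
  apply/lee_addgt0Pr => e e0; rewrite -EFinD.
  have /rat_in_itvoo[q] : x < x + e by rewrite ltrDl.
  rewrite in_itv/= => /andP[xq /ltW qe].
  apply: (@le_trans _ _ (ratr q)%:E); last by rewrite lee_fin.
  by apply: ereal_inf_lbound; exists (pickle q); rewrite /nth_rat /= pickleK.
move=> [x y]; rewrite /retract_plane /ecut /index_inf /embed_plane; congr pair.
  rewrite [X in ereal_inf X](_ : _ = [set (ratr (nth_rat n))%:E | n in [set n | x < ratr (nth_rat n)]]) ?infE//.
  by congr image; apply/seteqP; split => n /=; rewrite bitE /plane_bits odd_double doubleK.
rewrite [X in ereal_inf X](_ : _ = [set (ratr (nth_rat n))%:E | n in [set n | y < ratr (nth_rat n)]]) ?infE//.
by congr image; apply/seteqP; split => n /=; rewrite bitE /plane_bits /= odd_double /= uphalf_double.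
Qed.

Lemma measurable_embed_plane : measurable_fun setT embed_plane.
Proof.
apply: (measurable_fun_cvg (h := fun n p => series (bit_term R (plane_bits p)) n)).
  move=> n; rewrite /series/=; apply: measurable_sum => i.
  apply: measurable_funM => //.
  rewrite (_ : (fun p => _) = fun p => if plane_bits p i then 1 else 0); last first.
    by apply/funext => p; case: plane_bits.
  apply: measurable_fun_ifT => //; rewrite /plane_bits.
  by case: (odd i); exact: measurable_fun_ltr.
by move=> p _; exact: cvg_bit_sum.
Qed.

Lemma measurable_ecut c : measurable_fun setT (ecut c).
Proof. by apply: measurable_index_inf => n; exact: measurable_bit. Qed.

Lemma measurable_retract_plane : measurable_fun setT retract_plane.
Proof.
apply: measurable_fun_pair; apply: measurableT_comp; [exact: fine_measurable|exact: measurable_ecut|exact: fine_measurable|exact: measurable_ecut].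
Qed.

End plane_embedding.

(** * Codes for distribution functions, and a universal sampler *)

Section coding.
Context (R : realType).

(* [z] codes a distribution function [F] by the set of rational pairs
   [(q', p)] with [p <= F q']; taking a supremum over [q' <= q] makes every code
   monotone. *)
Definition code_cdf (q : rat) (z : baire) : R :=
  sup [set x | x = 0 \/ exists q' p : rat, [/\ q' <= q, 0 <= p <= 1,
    (z : nat -> nat) (pickle (q', p)) = 1%N & x = ratr p]].

Let code_set (q : rat) (z : baire) : set R :=
  [set x | x = 0 \/ exists q' p : rat, [/\ q' <= q, 0 <= p <= 1,
    (z : nat -> nat) (pickle (q', p)) = 1%N & x = ratr p]].

Let code_set_ub q z : ubound (code_set q z) 1.
Proof.
by move=> _ [->//|[q' [p [_ /andP[_ p1] _ ->]]]]; rewrite -(rmorph1 ratr) ler_rat.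
Qed.

Let has_sup_code_set q z : has_sup (code_set q z).
Proof. by split; [exists 0; left|exists 1; exact: code_set_ub]. Qed.

Lemma code_cdf01 q z : 0 <= code_cdf q z <= 1.
Proof.
apply/andP; split; first by apply: ub_le_sup; [case: (has_sup_code_set q z)|left].
by apply: ge_sup; [case: (has_sup_code_set q z)|exact: code_set_ub].
Qed.

Lemma code_cdf_nd z q q' : q <= q' -> code_cdf q z <= code_cdf q' z.
Proof.
move=> qq'; apply: ge_sup; first by case: (has_sup_code_set q z).
move=> x Hx; apply: ub_le_sup; first by case: (has_sup_code_set q' z).
case: Hx => [|[r [p [rq p01 zp ->]]]]; first by left.
by right; exists r, p; split => //; exact: le_trans qq'.
Qed.

(** The supremum exceeds [x] exactly when [x < 0] or some listed pair does, and each pair is a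
    condition on one coordinate of the code. *)
Lemma measurable_code_cdf q : measurable_fun setT (code_cdf q).
Proof.
move=> _; apply: (measurability _ (RGenOInfty.measurableE R)) => // _ [_ [x ->] <-].
rewrite setTI.
rewrite (_ : _ @^-1` _ = [set _ | x < 0] `|` \bigcup_(r in [set r : rat * rat | r.1 <= q /\
    0 <= r.2 <= 1 /\ x < ratr r.2]) [set z : baire | (z : nat -> nat) (pickle r) = 1%N]).
  apply: measurableU.
    by have [x0|x0] := pselect (x < 0); [rewrite (_ : [set _ | _] = setT)|rewrite (_ : [set _ | _] = set0)] => //;
      apply/seteqP; split.
  rewrite bigcup_mkcond; apply: countable_bigcupT_measurable => // r; case: ifP => // _.
  exact: (measurable_baire_coord (pickle r) (fun n => n = 1%N)).
apply/seteqP; split => z /=; rewrite in_itv/= andbT.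
  move=> /(sup_gt (has_sup_code_set q z).1)[_ [->|[q' [p [qq' p01 zp ->]]]] xp]; first by left.
  by right; exists (q', p).
case=> [x0|[[q' p] /= [qq' [p01 xp]] zp]]; first by case/andP: (code_cdf01 q z) => /(lt_le_trans x0).
apply: (lt_le_trans xp); apply: ub_le_sup; first by case: (has_sup_code_set q z).
by right; exists q', p.
Qed.

Lemma code_cdf_surj (F : rat -> R) : (forall q, 0 <= F q <= 1) ->
  (forall q q', q <= q' -> F q <= F q') ->
  exists z, forall q, code_cdf q z = F q.
Proof.
move=> F01 ndF.
pose z n : nat := if @unpickle (rat * rat)%type n is Some r then nat_of_bool (ratr r.2 <= F r.1)%R else 0%N.
have zE q p : (z (pickle (q, p)) = 1%N) <-> ratr p <= F q.
  by rewrite /z pickleK/=; case: (ratr p <= F q); split.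
exists z => q; apply/le_anti/andP; split.
  apply: ge_sup; first by case: (has_sup_code_set q z).
  move=> _ [->|[q' [p [qq' _ /zE pF ->]]]]; first by case/andP: (F01 q).
  by apply: (le_trans pF); exact: ndF.
(* A rational strictly between the decoded value and [F q] would itself be listed, hence bounded by
   the supremum. *)
rewrite leNgt; apply/negP => /rat_in_itvoo[p]; rewrite in_itv/= => /andP[cp pF].
have := cp; apply/negP; rewrite -leNgt.
apply: ub_le_sup; first by case: (has_sup_code_set q z).
right; exists q, p; split => //; last by apply/zE; exact: ltW.
have /andP[c0 _] := code_cdf01 q z; have /andP[_ F1] := F01 q.
apply/andP; split; rewrite -(ler_rat R) ?rmorph0 ?rmorph1.
  exact: le_trans c0 (ltW cp).
exact: le_trans (ltW pF) F1.
Qed.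

Definition code_sample (p : baire * R) : R * R :=
  retract_plane (quantile code_cdf p).

Lemma measurable_code_sample : measurable_fun setT code_sample.
Proof.
apply: measurableT_comp; first exact: measurable_retract_plane.
exact: (measurable_quantile measurable_code_cdf).
Qed.

(** Embed [P] in the line, code its distribution function, and apply the quantile theorem with base
    law the Dirac mass at the code: conditioning on the code is then vacuous. *)
Lemma code_sample_surj (P : probability (R * R)%type R) :
  exists z, forall B, measurable B -> unif R ((fun u => code_sample (z, u)) @^-1` B) = P B.
Proof.
pose P1 : probability R R := law P (@measurable_embed_plane R).
pose F q := fine (P1 `]-oo, (ratr q : R)]%classic).
have FE q : (F q)%:E = P1 `]-oo, (ratr q : R)]%classic by rewrite fineK// fin_num_measure.
have [z zF] : exists z, forall q, code_cdf q z = F q.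
  apply: code_cdf_surj => [q|q q' qq'].
    by rewrite -!lee_fin FE measure_ge0 probability_le1.
  rewrite -lee_fin !FE; apply: le_measure; rewrite ?inE// => x /=.
  by rewrite !in_itv/= => /le_trans; apply; rewrite ler_rat.
exists z => B mB.
have mz : measurable_fun setT (fun x : R => (z, x)) by exact: measurable_fun_pair.
pose P2 : probability (baire * R)%type R := law P1 mz.
pose eta : probability baire R := \d_z.
have mrB : measurable (@retract_plane R @^-1` B).
  by rewrite -[X in measurable X]setTI; exact: (@measurable_retract_plane R measurableT _ mB).
have aP q A : measurable A ->
    (\int[eta]_(t in A) (code_cdf q t)%:E)%E = P2 (A `*` `]-oo, ratr q]%classic).
  move=> mA; rewrite /eta integral_dirac//; last first.
    by apply/measurable_EFinP/measurable_funTS; exact: measurable_code_cdf.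
  rewrite zF FE /P2 lawE diracE; have [zA|zA] := boolP (z \in A).
    rewrite mul1e; congr (P1 _); apply/seteqP; split => x /=; last by case.
    by move=> xq; split => //=; exact: set_mem.
  rewrite mul0e -[LHS](measure0 P1); congr (P1 _); apply/seteqP; split => // x [/= /mem_set].
  by rewrite (negbTE zA).
have := quantile_law measurable_code_cdf code_cdf01 code_cdf_nd aP
  (B := setT `*` (@retract_plane R @^-1` B)) (measurableX measurableT mrB).
rewrite [in RHS]/P2 lawE.
have mC : measurable ((fun p => (p.1, quantile code_cdf p)) @^-1`
    (setT `*` (@retract_plane R @^-1` B))).
  have mq : measurable_fun setT (fun p : baire * R => (p.1, quantile code_cdf p)).
    by apply: measurable_fun_pair => //; exact: (measurable_quantile measurable_code_cdf).
  by rewrite -[X in measurable X]setTI; exact: (mq measurableT _ (measurableX measurableT mrB)).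
rewrite /= {1}/product_measure1 integral_dirac//; last exact: measurable_fun_xsection.
rewrite diracT mul1e => E.
transitivity (P1 (@retract_plane R @^-1` B)).
  apply: etrans (etrans _ E) _.
    by congr (unif R _); apply/seteqP; split => u; rewrite /xsection/= inE //= => -[].
  by congr (P1 _); apply/seteqP; split => x //= -[].
rewrite /P1 lawE; congr (P _); apply/seteqP; split => p /=; by rewrite embed_planeK.
Qed.

End coding.

(** * The fused Gromov-Wasserstein discrepancy *)

Section pushforward_integrals.
Context d1 d2 (T1 : measurableType d1) (T2 : measurableType d2) (R : realType).
Variables (G : probability T1 R) (P : probability T2 R) (f : T1 -> T2).
Hypothesis mf : measurable_fun setT f.
Hypothesis GP : forall B, measurable B -> G (f @^-1` B) = P B.
Local Open Scope ereal_scope.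

Lemma integral_image (h : T2 -> \bar R) : measurable_fun setT h ->
  (forall y, 0 <= h y) -> \int[P]_y h y = \int[G]_x h (f x).
Proof.
move=> mh h0; rewrite -(integral_law G mf)//.
by apply: eq_measure_integral => A mA _; symmetry; exact: GP.
Qed.

(** The distortion compares two independent draws; as an integral over a product it can be pulled
    back and handled like the transport term. *)
Lemma integral_image2 (h : T2 * T2 -> \bar R) : measurable_fun setT h ->
  (forall y, 0 <= h y) ->
  \int[P]_y \int[P]_y' h (y, y') = \int[G \x G]_x h (f x.1, f x.2).
Proof.
move=> mh h0.
have mff : measurable_fun setT (fun x : T1 * T1 => (f x.1, f x.2)).
  by apply: measurable_fun_pair; exact: measurableT_comp.
rewrite fubini_tonelli1//; last exact: (measurableT_comp mh mff).
rewrite /fubini_F/=.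
have mF : measurable_fun setT (fun y => \int[P]_y' h (y, y')).
  exact: (measurable_fun_fubini_tonelli_F (m2 := P) h mh h0).
rewrite (integral_image mF); last by move=> y; exact: integral_ge0.
apply: eq_integral => x _; rewrite integral_image//.
exact: (measurableT_comp mh).
Qed.

End pushforward_integrals.

Section fused_cost.
Context (R : realType) (beta : R) (d1 : R -> R -> R).
Hypothesis beta01 : 0 <= beta <= 1.
Hypothesis d1_ge0 : forall x y, 0 <= d1 x y.
Hypothesis md1 : measurable_fun [set: R * R] (fun p : R * R => d1 p.1 p.2).
Local Open Scope ereal_scope.

Let beta_ge0 : 0 <= beta%:E.
Proof. by rewrite lee_fin; case/andP: beta01. Qed.

Let cbeta_ge0 : 0 <= (1 - beta)%:E.
Proof. by rewrite lee_fin subr_ge0; case/andP: beta01. Qed.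

Definition distortion (x : (R * R) * (R * R)) : R :=
  ((d1 x.1.1 x.2.1 - d1 x.1.2 x.2.2) ^+ 2)%R.

Lemma measurable_d1 d (T : measurableType d) (f g : T -> R) :
  measurable_fun setT f -> measurable_fun setT g ->
  measurable_fun setT (fun x => (d1 (f x) (g x))%:E).
Proof.
move=> mf mg; apply/measurable_EFinP.
exact: (measurableT_comp md1 (measurable_fun_pair mf mg)).
Qed.

Lemma measurable_distortion : measurable_fun setT (fun x => (distortion x)%:E).
Proof.
apply/measurable_EFinP; apply: measurable_funX; apply: measurable_funB;
  apply/measurable_EFinP; apply: measurable_d1; by
    [exact: (measurableT_comp measurable_fst)|exact: (measurableT_comp measurable_snd)].
Qed.

(** The cost depends only on a random pair with law [P], on whatever space it is realised: swapped
    pairs, glued triples and coded samples all use this. *)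
Lemma fgw_cost_image d (T : measurableType d) (G : probability T R)
    (P : probability (R * R)%type R) (f : T -> R * R) :
  measurable_fun setT f -> (forall B, measurable B -> G (f @^-1` B) = P B) ->
  fgw_cost beta d1 P =
    (1 - beta)%:E * \int[G]_x (d1 (f x).1 (f x).2)%:E +
    beta%:E * \int[G \x G]_x (distortion (f x.1, f x.2))%:E.
Proof.
move=> mf GP; rewrite /fgw_cost; congr (_ * _ + _ * _).
  rewrite (integral_image mf GP (h := fun p => (d1 p.1 p.2)%:E))//.
  - exact: measurable_d1.
  - by move=> y; rewrite lee_fin.
rewrite -(integral_image2 mf GP (h := fun p => (distortion p)%:E))//.
- exact: measurable_distortion.
- by move=> y; rewrite lee_fin sqr_ge0.
Qed.

Lemma fgw_cost_ge0 P : 0 <= fgw_cost beta d1 P.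
Proof.
apply: adde_ge0; apply: mule_ge0 => //; apply: integral_ge0 => x _; rewrite ?lee_fin//.
by apply: integral_ge0 => y _; rewrite lee_fin sqr_ge0.
Qed.

Lemma D_fgw_ge0 rho eta : 0 <= D_fgw rho eta beta d1.
Proof. by apply: le_ereal_inf_tmp => _ [P _ <-]; exact: fgw_cost_ge0. Qed.

Lemma D_fgw_sym_le rho eta : (forall x y, d1 x y = d1 y x) ->
  D_fgw rho eta beta d1 <= D_fgw eta rho beta d1.
Proof.
move=> d1_sym; apply: le_ereal_inf_tmp => _ [P [P1 P2] <-].
have msw : measurable_fun setT (fun p : R * R => (p.2, p.1)).
  exact: measurable_fun_pair.
pose Q := law P msw.
apply: ge_ereal_inf; exists (fgw_cost beta d1 Q).
  exists Q; last by [].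
  by split=> A mA; [exact: P2|exact: P1].
rewrite (fgw_cost_image msw (G := P) (P := Q))//.
have mid : measurable_fun setT (fun x : R * R => x) by exact: measurable_id.
rewrite (fgw_cost_image mid (G := P) (P := P))//.
have -> : \int[P]_x (d1 (x.2, x.1).1 (x.2, x.1).2)%:E = \int[P]_x (d1 x.1 x.2)%:E.
  by apply: eq_integral => x _ /=; rewrite d1_sym.
rewrite le_eqVlt; apply/orP; left; apply/eqP; congr (_ + _ * _).
by apply: eq_integral => x _; rewrite /distortion/= -sqrrN opprB.
Qed.

Lemma D_fgw_sym rho eta : (forall x y, d1 x y = d1 y x) ->
  D_fgw rho eta beta d1 = D_fgw eta rho beta d1.
Proof. by move=> d1_sym; apply/le_anti; rewrite !D_fgw_sym_le. Qed.

Variable C : R.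
Hypothesis C_gt0 : (0 < C)%R.
Hypothesis d1_triangle : forall x y z, (d1 x z <= C * (d1 x y + d1 y z))%R.

(** With all three costs written on the glued space, the bound is pointwise under the integrals; [S]
    is the law of the two outer coordinates. *)
Lemma fgw_cost_glue P Q rho eta xi : couplings rho eta P -> couplings eta xi Q ->
  exists2 S, couplings rho xi S &
    fgw_cost beta d1 S <= (Num.max C 2%R)%:E * (fgw_cost beta d1 P + fgw_cost beta d1 Q).
Proof.
set K := Num.max C _; have K_ge0 : (0 <= K)%R by rewrite le_max ltW.
move=> [P1 P2] [Q1 Q2].
have PQ A : measurable A -> P (snd @^-1` A) = Q (fst @^-1` A).
  by move=> mA; rewrite P2// Q1.
have [G [GP GQ]] := gluing PQ.
have m1 : measurable_fun setT (fun x : R * R * R => x.1.1) by exact: (measurableT_comp measurable_fst).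
have m2 : measurable_fun setT (fun x : R * R * R => x.1.2) by exact: (measurableT_comp measurable_snd).
have mp12 : measurable_fun setT (fun x : R * R * R => (x.1.1, x.1.2)) by exact: measurable_fun_pair.
have mp23 : measurable_fun setT (fun x : R * R * R => (x.1.2, x.2)) by exact: measurable_fun_pair.
have mp13 : measurable_fun setT (fun x : R * R * R => (x.1.1, x.2)) by exact: measurable_fun_pair.
exists (law G mp13).
  split=> A mA; rewrite lawE.
  - rewrite -P1// -GP//.
    by rewrite -[X in measurable X]setTI; exact: measurable_fst.
  - rewrite -Q2// -GQ//.
    by rewrite -[X in measurable X]setTI; exact: measurable_snd.
rewrite (fgw_cost_image mp13 (G := G) (P := law G mp13))//.
rewrite (fgw_cost_image mp12 GP) (fgw_cost_image mp23 GQ) /=.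
set W13 := \int[G]_x _; set E13 := \int[G \x G]_x _.
set W12 := \int[G]_x _; set E12 := \int[G \x G]_x _.
set W23 := \int[G]_x _; set E23 := \int[G \x G]_x _.
have W12_ge0 : 0 <= W12 by apply: integral_ge0 => x _; rewrite lee_fin.
have W23_ge0 : 0 <= W23 by apply: integral_ge0 => x _; rewrite lee_fin.
have E12_ge0 : 0 <= E12 by apply: integral_ge0 => x _; rewrite lee_fin sqr_ge0.
have E23_ge0 : 0 <= E23 by apply: integral_ge0 => x _; rewrite lee_fin sqr_ge0.
have mpair (f : R * R * R -> R * R) : measurable_fun setT f ->
    measurable_fun setT (fun x : (R * R * R) * (R * R * R) => (distortion (f x.1, f x.2))%:E).
  move=> mf; apply: (measurableT_comp measurable_distortion (g := fun x => (f x.1, f x.2))).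
  by apply: measurable_fun_pair; exact: measurableT_comp.
have K0 : 0 <= K%:E by rewrite lee_fin.
have lin d (T : measurableType d) (m : {measure set T -> \bar R}) (f g h : T -> R) :
    (forall x, 0 <= f x)%R -> (forall x, 0 <= g x)%R -> (forall x, 0 <= h x)%R ->
    measurable_fun setT (fun x => (f x)%:E) -> measurable_fun setT (fun x => (g x)%:E) ->
    measurable_fun setT (fun x => (h x)%:E) ->
    (forall x, h x <= K * (f x + g x))%R ->
    \int[m]_x (h x)%:E <= K%:E * (\int[m]_x (f x)%:E + \int[m]_x (g x)%:E).
  move=> f0 g0 h0 mf mg mh hfg.
  have mfg : measurable_fun setT (fun x => (f x)%:E + (g x)%:E) by exact: emeasurable_funD.
  rewrite -ge0_integralD//; [|by move=> x _; rewrite lee_fin..].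
  rewrite -ge0_integralZl//; last by move=> x _; rewrite adde_ge0// lee_fin.
  apply: ge0_le_integral => //.
  - by move=> x _; rewrite lee_fin.
  - exact: measurable_funeM.
  - by move=> x _; rewrite -EFinD -EFinM lee_fin.
have leW : W13 <= K%:E * (W12 + W23).
  apply: lin => //; [exact: measurable_d1..|] => x.
  apply: (le_trans (d1_triangle _ x.1.2 _)); apply: ler_wpM2r; first exact: addr_ge0.
  by rewrite le_max lexx.
have leE : E13 <= K%:E * (E12 + E23).
  apply: lin => //; [by move=> x; exact: sqr_ge0..|exact: mpair mp12|exact: mpair mp23|exact: mpair mp13|].
  move=> x; rewrite /distortion/=.
  set a := d1 _ _; set c := d1 _ _; set b := d1 x.1.1.2 x.2.1.2.
  apply: (@le_trans _ _ (2 * ((a - b) ^+ 2 + (b - c) ^+ 2))%R).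
    (* The difference of the two sides is exactly [(a - 2 * b + c) ^+ 2]. *)
    by rewrite -subr_ge0; have := sqr_ge0 (a - 2 * b + c); lra.
  by apply: ler_wpM2r; [rewrite addr_ge0 ?sqr_ge0|rewrite le_max lexx orbT].
apply: (@le_trans _ _ ((1 - beta)%:E * (K%:E * (W12 + W23)) + beta%:E * (K%:E * (E12 + E23)))).
  by apply: leeD; apply: lee_pmul => //; apply: integral_ge0 => x _; rewrite lee_fin ?sqr_ge0.
clearbody W12 E12 W23 E23; rewrite muleCA [X in _ + X]muleCA -ge0_muleDr ?mule_ge0 ?adde_ge0//.
by rewrite [X in _ * (X + _) <= _]ge0_muleDr// [X in _ * (_ + X) <= _]ge0_muleDr// addeACA.
Qed.

Lemma D_fgw_triangle rho eta xi :
  D_fgw rho xi beta d1 <=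
  (Num.max C 2%R)%:E * (D_fgw rho eta beta d1 + D_fgw eta xi beta d1).
Proof.
set K := Num.max C _.
have K_gt0 : (0 < K)%R by rewrite lt_max C_gt0.
have D1_ge0 := D_fgw_ge0 rho eta; have D2_ge0 := D_fgw_ge0 eta xi.
have [D1y|D1y] := eqVneq (D_fgw rho eta beta d1) +oo.
  by rewrite D1y addye ?gt0_muley ?lte_fin ?leey// gt_eqF// (lt_le_trans _ D2_ge0).
have [D2y|D2y] := eqVneq (D_fgw eta xi beta d1) +oo.
  by rewrite D2y addey ?gt0_muley ?lte_fin ?leey// gt_eqF// (lt_le_trans _ D1_ge0).
have D1f : D_fgw rho eta beta d1 \is a fin_num by rewrite ge0_fin_numE// ltey.
have D2f : D_fgw eta xi beta d1 \is a fin_num by rewrite ge0_fin_numE// ltey.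
apply/lee_addgt0Pr => e e0.
(* Near-optimal couplings replace minimisers. Each gets half of [e / K], since gluing multiplies the
   total error by [K]. *)
have e'0 : (0 < e / (2 * K))%R by rewrite divr_gt0// mulr_gt0.
have [_ [P cP <-] ltP] := lb_ereal_inf_adherent e'0 D1f.
have [_ [Q cQ <-] ltQ] := lb_ereal_inf_adherent e'0 D2f.
have [S cS leS] := fgw_cost_glue cP cQ.
apply: (@le_trans _ _ (fgw_cost beta d1 S)); first by apply: ereal_inf_lbound; exists S.
apply: (le_trans leS).
apply: (@le_trans _ _ (K%:E * (D_fgw rho eta beta d1 + D_fgw eta xi beta d1 + (e / K)%:E))).
  apply: lee_wpmul2l; first by rewrite lee_fin ltW.
  apply: (le_trans (leeD (ltW ltP) (ltW ltQ))).
  rewrite addeACA leeD2l// -EFinD lee_fin le_eqVlt; apply/orP; left; apply/eqP.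
  by field; rewrite gt_eqF.
rewrite ge0_muleDr ?adde_ge0//; last by rewrite lee_fin divr_ge0// ltW.
by rewrite -[X in _ + X <= _]EFinM mulrC divfK// gt_eqF.
Qed.

End fused_cost.

(** * Measurable minorants of the discrepancy *)

Section lower_integrals.
Import HBNNSimple.
Context d (X : measurableType d) (R : realType).
Local Open Scope ereal_scope.

Lemma ge0_le_lower_integral (m : {measure set X -> \bar R}) (f g : X -> \bar R) :
  (forall x, 0 <= f x) -> (forall x, f x <= g x) ->
  \int[m]_x f x <= \int[m]_x g x.
Proof.
move=> f0 fg; rewrite !ge0_integralTE//; last by move=> x; exact: le_trans (fg x).
apply: le_ereal_sup => _ [h /= hf <-]; exists h => // x.
exact: le_trans (fg x).
Qed.

(** The bound [g <= f] holds everywhere, so that lower integrals compare without any measurability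
    of [f]; only the converse bound has a null exception. *)
Definition lower_version (m : {measure set X -> \bar R}) (f g : X -> \bar R) :=
  [/\ measurable_fun setT g, forall x, 0 <= g x, forall x, g x <= f x &
    exists N, [/\ measurable N, m N = 0 & forall x, ~ N x -> f x <= g x]].

(* The integral of a non-measurable function is a lower integral, which is
   only superadditive; measurable versions restore subadditivity. *)
Lemma lower_integral_subadditive (m M : {measure set X -> \bar R})
    (f g h g' h' : X -> \bar R) (K : R) :
  (forall N, measurable N -> m N = 0 -> M N = 0) ->
  (0 <= K)%R -> (forall x, 0 <= f x) ->
  (forall x, f x <= K%:E * (g x + h x)) ->
  lower_version m g g' -> lower_version m h h' ->
  \int[M]_x f x <= K%:E * (\int[M]_x g x + \int[M]_x h x).
Proof.
move=> mM K0 f0 fgh [mg' g'0 g'g [N1 [mN1 N10 gN1]]] [mh' h'0 h'h [N2 [mN2 N20 hN2]]].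
have mgh : measurable_fun setT (fun x => K%:E * (g' x + h' x)).
  by apply: measurable_funeM; exact: emeasurable_funD.
have gh0 x : 0 <= K%:E * (g' x + h' x) by rewrite mule_ge0 ?adde_ge0.
apply: (@le_trans _ _ (\int[M]_x (K%:E * (g' x + h' x)))); last first.
  rewrite ge0_integralZl//; last 2 first.
  - exact: emeasurable_funD.
  - by move=> x _; rewrite adde_ge0.
  rewrite ge0_integralD//; apply: lee_wpmul2l => //.
  by apply: leeD; exact: ge0_le_lower_integral.
(* The lower integral is a supremum over simple functions below [f]. Each is measurable, so it may
   be compared almost everywhere with the measurable combination of [g'] and [h']. *)
rewrite ge0_integralTE//; apply: ge_ereal_sup => _ [s /= sf <-].
have -> : sintegral M s = \int[M]_x (s x)%:E by rewrite integral_nnsfun// patch_setT.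
apply: ae_ge0_le_integral => //.
- by move=> x _; rewrite lee_fin.
- exact/measurable_EFinP.
exists (N1 `|` N2); split; first exact: measurableU.
  by apply: null_set_setU => //; exact: mM.
move=> x /= /not_implyP[_ nle]; apply: contrapT => /not_orP[N1x N2x]; apply: nle.
apply: (le_trans (sf x)); apply: (le_trans (fgh x)); apply: lee_wpmul2l => //.
by apply: leeD; [exact: gN1|exact: hN2].
Qed.

(** The infimum of the rationals [q] with [x] in the outer set [B q] lies below [f], and it can be
    smaller only where some [B q] exceeds its inner set [A q]. *)
Lemma lower_version_exists (m : {measure set X -> \bar R}) (f : X -> \bar R) :
  (forall x, 0 <= f x) ->
  (forall q : rat, exists A B, [/\ measurable A, measurable B,
    A `<=` [set x | f x < (ratr q)%:E], [set x | f x < (ratr q)%:E] `<=` B &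
    m (B `\` A) = 0]) ->
  exists g, lower_version m f g.
Proof.
move=> f0 /choice[A /choice[B HAB]].
have mA q : measurable (A q) by have [] := HAB q.
have mB q : measurable (B q) by have [] := HAB q.
(* For negative [q] the sublevel set is empty, but [B q] may still be a nonempty null set and would
   make [g] negative. *)
pose B' (q : rat) := if (0 <= q)%R then B q else set0.
have mB' q : measurable (B' q) by rewrite /B'; case: ifP.
pose g := index_inf (fun q => ratr q : R) B'.
have g0 x : 0 <= g x.
  apply: le_ereal_inf_tmp => _ [q /= + <-]; rewrite /B'; case: ifPn => // q0 _.
  by rewrite lee_fin ler0q.
exists g; split => //.
- exact: measurable_index_inf.
- move=> x; rewrite leNgt; apply/negP => fg.
  have [q fq qg] : exists2 q : rat, f x < (ratr q)%:E & (ratr q)%:E < g x.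
    have ff : f x \is a fin_num by rewrite ge0_fin_numE// (lt_le_trans fg)// leey.
    rewrite -(fineK ff) in fg *.
    case: (g x) fg => [s| |//].
      rewrite lte_fin => /rat_in_itvoo[q]; rewrite in_itv/= => /andP[fq qs].
      by exists q; rewrite lte_fin.
    move=> _; have /rat_in_itvoo[q] : (fine (f x) < fine (f x) + 1)%R by rewrite ltrDl.
    by rewrite in_itv/= => /andP[fq qs]; exists q; rewrite ?ltry// lte_fin.
  have q0 : (0 <= q)%R by rewrite -(ler0q R) -lee_fin (le_trans (f0 x))// ltW.
  move: qg; apply/negP; rewrite -leNgt; apply: ereal_inf_lbound; exists q => //=.
  by rewrite /B' q0; have [_ _ _ + _] := HAB q; apply.
pose N q := B q `\` A q.
have mN q : measurable (N q) by exact: measurableD.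
exists (\bigcup_q N q); split; first exact: countable_bigcupT_measurable.
  by apply: null_bigcup => // q; have [] := HAB q.
move=> x nN; rewrite leNgt; apply/negP => /index_inf_lt[q].
rewrite /B'; case: ifPn => // q0 Bx qf.
have Ax : A q x by apply: contrapT => nA; apply: nN; exists q.
have [_ _ + _ _] := HAB q => /(_ _ Ax) /=.
by move=> /(lt_trans qf); rewrite ltxx.
Qed.

End lower_integrals.

(** * Sublevel sets of the discrepancy as measurable projections *)

Section fgw_version.
Context (R : realType) (beta : R) (d1 : R -> R -> R).
Hypothesis beta01 : 0 <= beta <= 1.
Hypothesis d1_ge0 : forall x y, 0 <= d1 x y.
Hypothesis md1 : measurable_fun [set: R * R] (fun p : R * R => d1 p.1 p.2).
Local Open Scope ereal_scope.

(** The cost of the law coded by [z]. The integrating measures are fixed and [z] enters only the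
    integrand, so Tonelli's theorem gives measurability in [z]. *)
Definition code_cost (z : baire) : \bar R :=
  (1 - beta)%:E * \int[unif R]_u (d1 (code_sample (z, u)).1 (code_sample (z, u)).2)%:E +
  beta%:E * \int[unif R \x unif R]_x
    (distortion d1 (code_sample (z, x.1), code_sample (z, x.2)))%:E.

Lemma measurable_code_cost : measurable_fun setT code_cost.
Proof.
have mc d (T : measurableType d) (f : T -> baire) (g : T -> R) :
    measurable_fun setT f -> measurable_fun setT g ->
    measurable_fun setT (fun x => code_sample (f x, g x)).
  by move=> mf mg; exact: (measurableT_comp (@measurable_code_sample R) (measurable_fun_pair mf mg)).
pose h1 (p : baire * R) := (d1 (code_sample p).1 (code_sample p).2)%:E.
have mh1 : measurable_fun setT h1.
  by apply: measurable_d1 => //; apply: measurableT_comp => //; exact: measurable_code_sample.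
have h1_ge0 p : 0 <= h1 p by rewrite lee_fin.
pose pair_sample (p : baire * (R * R)) :=
  (@code_sample R (p.1, p.2.1), @code_sample R (p.1, p.2.2)).
have mpair : measurable_fun setT pair_sample.
  apply: measurable_fun_pair; apply: mc => //.
    exact: (measurableT_comp measurable_fst).
  exact: (measurableT_comp measurable_snd).
pose h2 (p : baire * (R * R)) := (distortion d1 (pair_sample p))%:E.
have mh2 : measurable_fun setT h2.
  exact: (measurableT_comp (measurable_distortion md1) mpair).
have h2_ge0 p : 0 <= h2 p by rewrite lee_fin sqr_ge0.
pose unif2 : probability (R * R)%type R := unif R \x unif R.
apply: emeasurable_funD; apply: measurable_funeM.
  exact: (measurable_fun_fubini_tonelli_F (m2 := unif R) h1 mh1 h1_ge0).
exact: (measurable_fun_fubini_tonelli_F (m2 := unif2) h2 mh2 h2_ge0).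
Qed.

Context dX (X : measurableType dX).

(** A probability kernel in disguise: [rho x] is a bare set function, and measurability in [x] is
    asked only on the rays that determine a law. *)
Definition measurable_family (rho : X -> set R -> \bar R) :=
  (forall x, exists P : probability R R, forall A, measurable A -> P A = rho x A) /\
  (forall q : rat, measurable_fun setT (fun x => rho x `]-oo, (ratr q : R)[%classic)).

Definition coded_couplings (rho eta : X -> set R -> \bar R) : set (X * baire) :=
  [set p | (forall q : rat, unif R ((fun u => (code_sample (p.2, u)).1) @^-1` `]-oo, ratr q[%classic)
              = rho p.1 `]-oo, ratr q[%classic) /\
           (forall q : rat, unif R ((fun u => (code_sample (p.2, u)).2) @^-1` `]-oo, ratr q[%classic)
              = eta p.1 `]-oo, ratr q[%classic)].

Lemma measurable_coded_couplings rho eta :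
  measurable_family rho -> measurable_family eta ->
  measurable (coded_couplings rho eta).
Proof.
have main (sel : R * R -> R) (r : X -> set R -> \bar R) : measurable_fun setT sel ->
    measurable_family r -> measurable [set p : X * baire | forall q : rat,
      unif R ((fun u => sel (code_sample (p.2, u))) @^-1` `]-oo, ratr q[%classic)
        = r p.1 `]-oo, (ratr q : R)[%classic].
  move=> msel [_ mr].
  rewrite (_ : [set _ | _] = \bigcap_q [set p : X * baire |
      unif R ((fun u => sel (code_sample (p.2, u))) @^-1` `]-oo, ratr q[%classic)
        = r p.1 `]-oo, (ratr q : R)[%classic]); last first.
    by apply/seteqP; split => p Hp q; [move=> _; exact: Hp|exact: (Hp q I)].
  rewrite -[X in measurable X]setCK setC_bigcap; apply: measurableC.
  apply: countable_bigcupT_measurable => // q; apply: measurableC.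
  rewrite -[X in measurable X]setTI; apply: measurable_eqe => //.
    pose E := (fun p : baire * R => sel (code_sample p)) @^-1` `]-oo, (ratr q : R)[%classic.
    have msc := measurableT_comp msel (@measurable_code_sample R).
    have mE : measurable E by rewrite -[X in measurable X]setTI; exact: msc.
    have mx : measurable_fun setT (unif R \o xsection E) by exact: measurable_fun_xsection.
    rewrite (_ : (fun _ => _) = (unif R \o xsection E) \o (@snd X baire)).
      exact: (measurableT_comp mx).
    apply/funext => p /=; congr (unif R _).
    by apply/seteqP; split => u; rewrite /xsection/E/= inE.
  exact: (measurableT_comp (mr q)).
move=> mrho meta; exact: (measurableI _ _ (main fst rho measurable_fst mrho) (main snd eta measurable_snd meta)).
Qed.

(** A strict bound on an infimum is witnessed by one coupling, attained or not, and every coupling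
    has a code. *)
Lemma D_fgw_lt_coded rho eta x (c : \bar R) :
  measurable_family rho -> measurable_family eta ->
  D_fgw (rho x) (eta x) beta d1 < c <->
  exists z, coded_couplings rho eta (x, z) /\ code_cost z < c.
Proof.
move=> [prho _] [peta _].
have mcz z : measurable_fun setT (fun u : R => code_sample (z, u)).
  apply: (measurableT_comp (@measurable_code_sample R) (g := fun u : R => (z, u))).
  exact: measurable_fun_pair.
split.
  move=> /ereal_inf_lt[_ [P [P1 P2] <-] Pc].
  have [z zP] := code_sample_surj P.
  exists z; split; last by rewrite (fgw_cost_image beta d1_ge0 md1 (mcz z) zP) in Pc.
  split => q /=.
    rewrite -P1// -zP//.
    by rewrite -[X in measurable X]setTI; exact: measurable_fst.
  rewrite -P2// -zP//.
  by rewrite -[X in measurable X]setTI; exact: measurable_snd.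
move=> [z [[/= z1 z2] zc]].
apply: le_lt_trans zc; apply: ge_ereal_inf; exists (fgw_cost beta d1 (law (unif R) (mcz z))).
  exists (law (unif R) (mcz z)); last by [].
  have [P HP] := prho x; have [Q HQ] := peta x.
  have m1 : measurable_fun setT (fun u : R => (code_sample (z, u)).1).
    exact: (measurableT_comp measurable_fst (mcz z)).
  have m2 : measurable_fun setT (fun u : R => (code_sample (z, u)).2).
    exact: (measurableT_comp measurable_snd (mcz z)).
  split => A mA.
    rewrite -HP//; apply: (ratrays_unique (m1 := law (unif R) m1) (m2 := P)) => // q.
    by apply: etrans (z1 q) _; rewrite -HP.
  rewrite -HQ//; apply: (ratrays_unique (m1 := law (unif R) m2) (m2 := Q)) => // q.
  by apply: etrans (z2 q) _; rewrite -HQ.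
by rewrite (fgw_cost_image beta d1_ge0 md1 (mcz z) (G := unif R)).
Qed.

Lemma D_fgw_lower_version (m : {finite_measure set X -> \bar R}) rho eta :
  measurable_family rho -> measurable_family eta ->
  exists g, lower_version m (fun x => D_fgw (rho x) (eta x) beta d1) g.
Proof.
move=> mrho meta; apply: lower_version_exists => [x|q]; first exact: D_fgw_ge0.
pose B : set (X * baire) :=
  coded_couplings rho eta `&` [set p | code_cost p.2 < (ratr q)%:E].
have mB : measurable B.
  apply: measurableI; first exact: measurable_coded_couplings.
  rewrite -[X in measurable X]setTI; apply: measurable_lte => //.
  exact: (measurableT_comp measurable_code_cost).
have [C [D [mC mD CB BD DC]]] := measurable_projection m mB.
have E : [set x | D_fgw (rho x) (eta x) beta d1 < (ratr q)%:E] = [set x | exists z, B (x, z)].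
  by apply/seteqP; split => x /=; rewrite D_fgw_lt_coded.
by exists C, D; rewrite E.
Qed.

End fgw_version.

(** * Surface measure and mixtures of von Mises-Fisher distributions *)

Section packing.
Context d (T : measurableType d) (R : realType).

Section raw.
Variable mu : set T -> \bar R.
Hypothesis mu0 : mu set0 = 0%E.
Hypothesis mu_ge0 : forall A, (0 <= mu A)%E.
Hypothesis mu_sigma : semi_sigma_additive mu.

Let raw (A : set T) := mu A.
HB.instance Definition _ := isMeasure.Build _ _ _ raw mu0 mu_ge0 mu_sigma.

(** [lebT], [surface] and [MovMF] are bare set functions; an equality with a genuine measure
    transfers integration theory to them by rewriting. *)
Lemma pack_measure : exists m : {measure set T -> \bar R}, mu = m.
Proof. by exists raw. Qed.

End raw.

Section finiteness.
Variable m : {measure set T -> \bar R}.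

Let raw (A : set T) := m A.
HB.instance Definition _ := Measure.copy raw m.

Section sigma_finite.
Hypothesis sm : sigma_finite setT m.

Let sraw (A : set T) := raw A.
HB.instance Definition _ := Measure.copy sraw raw.
HB.instance Definition _ := Measure_isSigmaFinite.Build _ _ _ sraw sm.

Lemma pack_sigma_finite : exists m' : {sigma_finite_measure set T -> \bar R},
  m = m' :> (set T -> \bar R).
Proof. by exists sraw. Qed.

End sigma_finite.

Section finite.
Hypothesis fm : fin_num_fun m.

Let fraw (A : set T) := raw A.
HB.instance Definition _ := Measure.copy fraw raw.
HB.instance Definition _ := Measure_isFinite.Build _ _ _ fraw fm.

Lemma pack_finite : exists m' : {finite_measure set T -> \bar R},
  m = m' :> (set T -> \bar R).
Proof. by exists fraw. Qed.

End finite.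
End finiteness.
End packing.

Section euclidean.
Context (R : realType).
Local Open Scope ereal_scope.

Lemma measurable_dotT d (T : measurableType d) n (f g : T -> n.-tuple R) :
  measurable_fun setT f -> measurable_fun setT g ->
  measurable_fun setT (fun x => dotT (f x) (g x)).
Proof.
move=> mf mg; rewrite /dotT; apply: measurable_sum => i.
apply: measurable_funM; first exact: (measurableT_comp (measurable_tnth i) mf).
exact: (measurableT_comp (measurable_tnth i) mg).
Qed.

Lemma dotT_scale n (t : R) (x : n.-tuple R) :
  dotT (scaleT t x) (scaleT t x) = (t ^+ 2 * dotT x x)%R.
Proof.
rewrite /dotT mulr_sumr; apply: eq_bigr => i _.
by rewrite !tnth_map mulrACA -expr2.
Qed.

Lemma dotT_ge0 n (x : n.-tuple R) : (0 <= dotT x x)%R.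
Proof. by apply: sumr_ge0 => i _; rewrite -expr2 sqr_ge0. Qed.

Lemma normT_sqr n (x : n.-tuple R) : (normT x ^+ 2 = dotT x x)%R.
Proof. by rewrite sqr_sqrtr ?dotT_ge0. Qed.

Lemma measurable_normT n : measurable_fun setT (@normT R n).
Proof.
have msqrt : measurable_fun setT (@Num.sqrt R).
  by apply: continuous_measurable_fun; exact: sqrt_continuous.
by apply: (measurableT_comp msqrt); apply: measurable_dotT; exact: measurable_id.
Qed.

Lemma measurable_normalize n :
  measurable_fun setT (fun x : n.-tuple R => scaleT (normT x)^-1 x).
Proof.
apply/measurable_fun_tnthP => i.
rewrite (_ : _ \o _ = fun x : n.-tuple R => ((normT x)^-1 * tnth x i)%R); last first.
  by apply/funext => x /=; rewrite tnth_map.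
apply: measurable_funM; last exact: measurable_tnth.
rewrite (_ : (fun _ => _) = (@powR R ^~ (-1)%R) \o @normT R n).
  exact: (measurableT_comp (measurable_powR (-1)%R) (@measurable_normT n)).
by apply/funext => x /=; rewrite powR_inv1// sqrtr_ge0.
Qed.

Definition punctured_ball n : set (n.-tuple R) :=
  [set x | (0 < normT x <= 1)%R].
Arguments punctured_ball : clear implicits.

Lemma measurable_punctured_ball n : measurable (punctured_ball n).
Proof.
rewrite (_ : punctured_ball n = @normT R n @^-1` `]0%R, 1%R]%classic).
  by rewrite -[X in measurable X]setTI; exact: measurable_normT.
by apply/seteqP; split => x /=; rewrite in_itv.
Qed.

(** In polar form, [t] is the norm and [y] the direction. Up to the factor [n], the surface measure
    is therefore the image, under normalisation, of Lebesgue measure on the punctured ball. *)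
Lemma coneE n (A : set (n.-tuple R)) :
  cone A = (fun x => scaleT (normT x)^-1 x) @^-1` A `&` punctured_ball n.
Proof.
have scaleK (t : R) (x : n.-tuple R) : (t != 0)%R -> scaleT t^-1 (scaleT t x) = x.
  by move=> t0; apply: eq_from_tnth => i; rewrite !tnth_map mulKf.
apply/seteqP; split => x.
  move=> [t [/andP[t0 t1] [y [Ay Sy] ->]]].
  have nt : normT (scaleT t y) = t.
    by rewrite /normT dotT_scale Sy mulr1 sqrtr_sqr gtr0_norm.
  by split; rewrite /= /punctured_ball /= nt ?t0// scaleK// gt_eqF.
move=> [/= Ax /andP[x0 x1]]; exists (normT x); split; first by rewrite x0.
exists (scaleT (normT x)^-1 x).
  by split => //; rewrite /sphere/= dotT_scale -normT_sqr -exprMn mulVf ?expr1n// gt_eqF.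
apply: eq_from_tnth => i; rewrite !tnth_map mulrA divff ?mul1r// gt_eqF//.
Qed.

Definition box n (j : nat) : set (n.-tuple R) :=
  [set x | forall i, (`|tnth x i| <= j%:R)%R].
Arguments box : clear implicits.

Lemma measurable_box n j : measurable (box n j).
Proof.
rewrite (_ : box n j = \bigcap_(i : 'I_n) [set x | (`|tnth x i| <= j%:R)%R]); last first.
  by apply/seteqP; split => x Hx i; [move=> _; exact: Hx|exact: (Hx i I)].
rewrite -[X in measurable X]setCK setC_bigcap; apply: measurableC.
apply: countable_bigcupT_measurable => // i; apply: measurableC.
rewrite -[X in measurable X]setTI; apply: measurable_fun_le => //.
by apply: measurableT_comp => //; exact: measurable_tnth.
Qed.

Lemma bigcup_box n : \bigcup_j box n j = setT.
Proof.
apply/seteqP; split => // x _.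
exists (\max_(i < n) (Num.trunc `|tnth x i|).+1)%N => // i.
apply/ltW/(lt_le_trans (truncnS_gt _)); rewrite ler_nat.
exact: (leq_bigmax (F := fun i => (Num.trunc `|tnth x i|).+1)).
Qed.

Lemma punctured_ball_box n : punctured_ball n `<=` box n 1.
Proof.
move=> x /andP[_ x1] i; rewrite -(@ler_pXn2r _ 2) ?nnegrE//.
rewrite expr1n real_normK ?num_real//; apply: (@le_trans _ _ (dotT x x)).
  rewrite /dotT (bigD1 i)//= -expr2 lerDl; apply: sumr_ge0 => j _.
  by rewrite -expr2 sqr_ge0.
by rewrite -normT_sqr exprn_ile1// sqrtr_ge0.
Qed.

(** Finiteness on boxes travels with the induction, because the product with the next factor
    requires sigma-finiteness. *)
Lemma lebT_measure n : exists2 m : {measure set (n.-tuple R) -> \bar R},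
  (@lebT R n = m) & (forall j, m (box n j) < +oo).
Proof.
elim: n => [|n [m mE moo]].
  exists (dirac [tuple]) => // j.
  by apply: (le_lt_trans (probability_le1 _ _)); [exact: measurable_box|exact: ltry].
have msf : sigma_finite setT m.
  by exists (box n); rewrite ?bigcup_box// => j; split; [exact: measurable_box|exact: moo].
have [m' mm'] := pack_sigma_finite msf.
pose P : {measure set (measurableTypeR R * n.-tuple R) -> \bar R} :=
  (@lebesgue_measure R \x m')%E.
pose c (p : measurableTypeR R * n.-tuple R) : n.+1.-tuple R := cons_tuple p.1 p.2.
have mc : measurable_fun setT c.
  have m1 : measurable_fun setT (fun p : measurableTypeR R * n.-tuple R => (p.1 : R)).
    exact: measurable_fst.
  by apply: (measurable_cons m1).
have lebS : @lebT R n.+1 = pushforward P c by rewrite /= mE mm'.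
have [||M ME] := pack_measure (mu := pushforward P c) _ (fun A => measure_ge0 P _) _.
- by rewrite /pushforward preimage_set0 measure0.
- by apply: measure_semi_sigma_additive.
exists M; first by rewrite lebS ME.
move=> j; rewrite -ME /pushforward.
have -> : c @^-1` box n.+1 j = `[(- j%:R)%R, (j%:R : R)%R]%classic `*` box n j.
  apply/seteqP; split => p /=.
    move=> Hp; split => /=; first by rewrite in_itv/= -ler_norml; exact: (Hp ord0).
    by move=> i; have := Hp (lift ord0 i); rewrite /c tnthS.
  rewrite in_itv/= -ler_norml => -[p1 p2] i; have [->//|i0] := eqVneq i ord0.
  have [k ->] : exists k, i = lift ord0 k.
    by case: (unliftP ord0 i) i0 => [k ->|->]; [exists k|rewrite eqxx].
  by rewrite /c tnthS; exact: p2.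
rewrite /P/= product_measure1E//; last exact: measurable_box.
have itv_lty : (@lebesgue_measure R) `[(- j%:R)%R, (j%:R : R)%R]%classic < +oo.
  by rewrite lebesgue_measure_itv/=; case: ifP => // _; rewrite -EFinB ltry.
rewrite -mm'; apply: lte_mul_pinfty => //.
by rewrite ge0_fin_numE.
Qed.

(** Finiteness, required by measurable projection, comes from the punctured ball lying in the box of
    half-side 1. *)
Lemma surface_measure n : exists m : {finite_measure set (n.-tuple R) -> \bar R},
  @surface R n = m.
Proof.
have [m mE moo] := lebT_measure n.
pose mr : {measure set (n.-tuple R) -> \bar R} := mrestr m (@measurable_punctured_ball n).
pose c (x : n.-tuple R) := scaleT (normT x)^-1 x.
have [||P PE] := pack_measure (mu := pushforward mr c) _ (fun A => measure_ge0 mr _) _.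
- by rewrite /pushforward preimage_set0 measure0.
- by apply: measure_semi_sigma_additive; exact: measurable_normalize.
pose S : {measure set (n.-tuple R) -> \bar R} := mscale (NngNum (ler0n R n)) P.
have SE : @surface R n = S.
  by apply/funext => A; rewrite /surface coneE mE /S/= /mscale/= -PE.
have [|F FE] := @pack_finite _ _ _ S; last by exists F; rewrite SE FE.
move=> A mA; rewrite /S/= /mscale/= fin_numM// -PE ge0_fin_numE; last exact: (measure_ge0 mr).
apply: le_lt_trans (moo 1%N); rewrite /pushforward /mr/= /mrestr; apply: le_measure; rewrite ?inE//.
- apply: measurableI; last exact: measurable_punctured_ball.
  by rewrite -[X in measurable X]setTI; exact: measurable_normalize.
- exact: measurable_box.
- by move=> x [_]; exact: punctured_ball_box.
Qed.

Lemma measurable_sphere n : measurable (@sphere R n).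
Proof.
rewrite (_ : @sphere R n = (fun x => dotT x x) @^-1` [set 1%R])//.
by rewrite -[X in measurable X]setTI; apply: measurable_dotT => //; exact: measurable_id.
Qed.

Lemma vmf_density_ge0 n (eps : n.-tuple R) kappa x : (0 <= vmf_density eps kappa x)%R.
Proof.
rewrite /vmf_density mulr_ge0 ?expR_ge0// /vmfC divr_ge0 ?powR_ge0// mulr_ge0 ?powR_ge0//.
rewrite fine_ge0//; apply: nneseries_ge0 => i _ _; rewrite lee_fin divr_ge0 ?powR_ge0//.
rewrite mulr_ge0// fine_ge0//; apply: integral_ge0 => t _.
by rewrite lee_fin mulr_ge0 ?powR_ge0 ?expR_ge0.
Qed.

Lemma measurable_vmf_density n (eps : n.-tuple R) kappa :
  measurable_fun setT (vmf_density eps kappa).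
Proof.
apply: measurable_funM => //.
apply: (measurableT_comp (@measurable_expR R)); apply: measurable_funM => //.
by apply: measurable_dotT; [exact: measurable_cst|exact: measurable_id].
Qed.

(** Each component has a nonnegative density against the surface measure, so exceptional sets found
    for that measure remain null for every mixture. *)
Lemma MovMF_measure n k (eps : 'I_k -> n.-tuple R) (kappa alpha : 'I_k -> R) :
  (forall i, 0 <= alpha i)%R ->
  exists2 M : {measure set (n.-tuple R) -> \bar R}, MovMF eps kappa alpha = M &
  forall N, measurable N -> @surface R n N = 0 -> M N = 0.
Proof.
move=> alpha_ge0; have [m mE] := surface_measure n.
have dens_ge0 i x : 0 <= (vmf_density (eps i) (kappa i) x)%:E.
  by rewrite lee_fin vmf_density_ge0.
have mdens i : measurable_fun setT (fun x => (vmf_density (eps i) (kappa i) x)%:E).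
  by apply/measurable_EFinP; exact: measurable_vmf_density.
have mix_ge0 i A : 0 <= (alpha i)%:E *
    \int[m]_(x in A `&` @sphere R n) (vmf_density (eps i) (kappa i) x)%:E.
  by apply: mule_ge0; [rewrite lee_fin|exact: integral_ge0].
have [|||M ME] := pack_measure (mu := MovMF eps kappa alpha).
- by rewrite /MovMF mE big1// => i _; rewrite set0I [X in _ * X](integral_set0 m) mule0.
- by move=> A; rewrite /MovMF mE; apply: sume_ge0.
- move=> F mF tF mUF; rewrite /MovMF mE.
  rewrite [X in _ --> X](_ : _ = lim ((fun j => \sum_(0 <= l < j) \sum_(i < k) (alpha i)%:E *
      \int[m]_(x in F l `&` @sphere R n) (vmf_density (eps i) (kappa i) x)%:E) @ \oo)).
    by apply: is_cvg_ereal_nneg_natsum => l _; exact: sume_ge0.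
  rewrite nneseries_sum//; apply: eq_bigr => /= i _.
  rewrite nneseriesZl//; last by move=> l _; exact: integral_ge0.
  congr (_ * _); rewrite setI_bigcupl ge0_integral_bigcup//.
  + by move=> l; apply: measurableI => //; exact: measurable_sphere.
  + exact: measurable_funTS.
  + by apply: trivIset_setIr.
exists M => // N mN N0; rewrite -ME /MovMF big1// => i _.
rewrite mE null_set_integral ?mule0//.
- by apply: measurableI => //; exact: measurable_sphere.
- exact: measurable_funTS.
- apply: (@subset_measure0 _ _ _ m _ N) => //; first by apply: measurableI => //; exact: measurable_sphere.
  by move: N0; rewrite mE.
Qed.

(** Guards the supremum defining the max-sliced discrepancy: over an empty set it would be minus
    infinity. *)
Lemma sphere_neq0 n : @sphere R n.+1 !=set0.
Proof.
exists [tuple ((i == ord0)%:R : R) | i < n.+1].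
rewrite /sphere/= /dotT (bigD1 ord0)//= big1 ?addr0 ?tnth_mktuple ?eqxx ?mulr1// => i i0.
by rewrite tnth_mktuple (negbTE i0) mul0r.
Qed.

Lemma measurable_family_proj_push n (mu : probability (n.-tuple R) R) :
  measurable_family (fun theta : n.-tuple R => proj_push theta mu).
Proof.
have mdot theta : measurable_fun setT (@dotT R n theta).
  by apply: measurable_dotT; [exact: measurable_cst|exact: measurable_id].
split => [theta|q]; first by exists (law mu (mdot theta)).
pose E := (fun p : n.-tuple R * n.-tuple R => dotT p.1 p.2) @^-1` `]-oo, (ratr q : R)%R[%classic.
have mE : measurable E.
  by rewrite -[X in measurable X]setTI; apply: measurable_dotT => //.
rewrite (_ : (fun _ => _) = mu \o xsection E); first exact: measurable_fun_xsection.
apply/funext => theta /=; rewrite /proj_push /pushforward; congr (mu _).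
by apply/seteqP; split => x; rewrite /xsection/E/= inE.
Qed.

End euclidean.

(** * The max-sliced discrepancy *)

Theorem theorem4 (R : realType) (d k : nat) (beta : R)
    (kappa alpha : 'I_k -> R) (d1 : R -> R -> R) :
  (2 <= d)%N -> (1 <= k)%N ->
  0 <= beta <= 1 ->
  (forall i, 0 < kappa i) ->
  (forall i, 0 <= alpha i) -> \sum_(i < k) alpha i = 1 ->
  pseudo_metric d1 ->
  measurable_fun [set: R * R] (fun p : R * R => d1 p.1 p.2) ->
  (* non-negativity *)
  (forall mu nu : probability (d.-tuple R) R,
      finite_moments mu -> finite_moments nu ->
      (0 <= MSSFG mu nu beta d1 kappa alpha)%E) /\
  (* symmetry *)
  (forall mu nu : probability (d.-tuple R) R,
      finite_moments mu -> finite_moments nu ->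
      MSSFG mu nu beta d1 kappa alpha = MSSFG nu mu beta d1 kappa alpha) /\
  (* quasi-triangle inequality *)
  (exists C' : R, 0 < C' /\
     forall mu nu xi : probability (d.-tuple R) R,
       finite_moments mu -> finite_moments nu -> finite_moments xi ->
       (MSSFG mu xi beta d1 kappa alpha <=
        C'%:E * (MSSFG mu nu beta d1 kappa alpha + MSSFG nu xi beta d1 kappa alpha))%E).
Proof.
move=> d2 _ beta01 _ alpha_ge0 _ [d1_ge0 [d1_sym [C [C_gt0 d1_triangle]]]] md1.
have D_ge0 := D_fgw_ge0 beta01 d1_ge0.
have S0 : @sphere R d !=set0 by case: d d2 => // n _; exact: sphere_neq0.
split; [|split].
- move=> mu nu _ _.
  have [x Sx] := S0.
  have [M ME _] := MovMF_measure (fun=> x) kappa alpha_ge0.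
  rewrite /MSSFG; apply: ereal_sup_ge.
  exists (\int[MovMF (fun=> x) kappa alpha]_theta
     D_fgw (proj_push theta mu) (proj_push theta nu) beta d1)%E; first by exists (fun=> x).
  by rewrite ME; apply: integral_ge0 => theta _; exact: D_ge0.
- move=> mu nu _ _; rewrite /MSSFG; congr ereal_sup; congr image.
  apply/funext => eps; congr (integral _ _ _); apply/funext => theta.
  exact: D_fgw_sym.
exists (Num.max C 2); split; first by rewrite lt_max C_gt0.
have K_ge0 : 0 <= Num.max C 2 by rewrite le_max ltW.
move=> mu nu xi _ _ _; apply: ge_ereal_sup => _ [eps Seps <-].
have [M ME nullM] := MovMF_measure eps kappa alpha_ge0.
have [m mE] := surface_measure R d.
have [g1 Hg1] := D_fgw_lower_version beta01 d1_ge0 md1 m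
  (measurable_family_proj_push mu) (measurable_family_proj_push nu).
have [g2 Hg2] := D_fgw_lower_version beta01 d1_ge0 md1 m
  (measurable_family_proj_push nu) (measurable_family_proj_push xi).
(* The intermediate bound keeps the same [eps] in both integrals; each is then at most its own
   supremum. *)
apply: (@le_trans _ _ ((Num.max C 2)%:E *
  (\int[MovMF eps kappa alpha]_theta D_fgw (proj_push theta mu) (proj_push theta nu) beta d1 +
   \int[MovMF eps kappa alpha]_theta D_fgw (proj_push theta nu) (proj_push theta xi) beta d1))%E).
  rewrite ME; apply: (lower_integral_subadditive _ K_ge0 _ _ Hg1 Hg2).
  - by move=> N mN N0; apply: nullM => //; rewrite mE.
  - by move=> theta; exact: D_ge0.
  - by move=> theta; exact: D_fgw_triangle.
apply: lee_wpmul2l; first by rewrite lee_fin.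
by apply: leeD; apply: ereal_sup_ubound; exists eps.
Qed.
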